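(* Consider the pursuit-evasion game on a sphere of radius $R$ with agent velocities $\vec v_E=v_E(\cos u_E\,\vec t_E+\sin u_E\,\vec n_{GC})$ and $\vec v_P=v_P(\cos u_P\,\vec t_P+\sin u_P\,\vec n_{GC})$ and time-to-capture cost $J=\int_0^\tau1\,\mathrm{d}t=\tau$. Here $P$ has constant speed $v_P>0$ and control variable $u_P\in[0,2\pi)$, and minimizes the time to capture; $E$ has control variables $v_E\in[0,\mu v_P]$ (with $0<\mu<1$) and $u_E\in[0,2\pi)$, and maximizes the time to capture. Then, for all possible relative positions $\alpha\in(0,\pi]$, the equilibrium actions for $P$ and $E$ are $$u_P=\begin{cases}0,&\alpha\in(0,\pi)\\ \text{any direction},&\alpha=\pi,\end{cases}\qquad (v_E,u_E)=\begin{cases}(\mu v_P,0),&\alpha\in(0,\pi)\\ (0,\text{any direction}),&\alpha=\pi.\end{cases}$$ For any initial condition $\alpha\in(0,\pi]$, with $P$ and $E$ following their equilibrium strategies, the time to capture $\tau$ satisfies $$\tau\le V(\alpha)=\frac{R\,\alpha}{(1-\mu)v_P}\qquad\text{for }\alpha\ne\pi,$$ and for $\alpha=\pi$, with $V(\pi)=\frac{R\pi}{(1-\mu)v_P}$, the difference $$V(\pi)-\tau=\varepsilon>0,$$ where $\varepsilon$ is an infinitesimally small value: $\varepsilon\to0$ as the initial hold time $h>0$ tends to $0$.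
   Context: A pursuer $P$ and an evader $E$ move on the sphere of radius $R$ centered at the origin of $\mathbb{R}^3$; their position vectors are $\vec P,\vec E$ with $|\vec P|=|\vec E|=R$. Both have simple motion: each player's velocity is tangent to the sphere and its direction is chosen freely and instantaneously. The angular distance is $\alpha\in[0,\pi]$, the angle between $\vec P$ and $\vec E$. For $\alpha\in(0,\pi)$ the unit vector $\vec n_{GC}$ is defined by $\vec n_{GC}\sin\alpha=\frac{1}{R^2}\vec P\times\vec E$; it is normal to the plane of the great circle through $P$ and $E$. The vectors $\vec t_P=\frac1R\vec n_{GC}\times\vec P$ and $\vec t_E=\frac1R\vec n_{GC}\times\vec E$ are the unit tangents to this great circle at $P$ and at $E$, oriented so that $\vec t_P$ points from $P$ toward $E$ along the shorter arc and $\vec t_E$ points away from $P$ (continuing in the same rotational sense). The headings $u_P,u_E$ are measured from these tangents, and $\dot\alpha=\frac{v_E}{R}\cos u_E-\frac{v_P}{R}\cos u_P$ for $\alpha\in(0,\pi)$. The capture time is $\tau=\inf\{t\mid\vec E=\vec P\}$. Strategies $\{\vec v_P^*,\vec v_E^*\}$ are (saddle point) equilibrium strategies if $\tau(\vec v_P^*,\vec v_E)\le\tau^*(\vec v_P^*,\vec v_E^* )\le\tau(\vec v_P,\vec v_E^* )$ for all admissible $\vec v_P,\vec v_E$. The case $\alpha=\pi$ ($\vec P=-\vec E$): infinitely many great circles pass through $P$ and $E$, and the one used is the one aligned with the direction of motion selected by $P$ (so that $u_P=0$ on it), with $u_E$ measured with respect to that great circle, which is unknown to $E$. Both players commit to their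 initial actions for a short hold time $h>0$ with $h\to0$, so that $\alpha(h)=\pi+\frac{v_Eh\cos u_E}{R}-\frac{v_Ph}{R}<\pi$. After the hold time they follow the equilibrium strategies for $\alpha\in(0,\pi)$, and the total time to capture is $\tau=h+V(\alpha(h))$. The equilibrium action of $E$ at $\alpha=\pi$ is understood as the one attaining the $\min$ over $v_E$, $\max$ over $u_E$ saddle value of the instantaneous rate of loss $$\mathcal L(v_E,u_E)=-\lim_{h\to0}\frac{V(\alpha(h))-V(\alpha(0))+h}{h},\qquad \alpha(0)=\pi .$$ *)

(* Defs.v *)
(* The reals are an arbitrary R : realType; the radius of the sphere is rho. *)
From HB Require Import structures.
From mathcomp Require Import all_boot all_order all_algebra.
From mathcomp Require Import all_classical all_reals all_analysis.

Set Implicit Arguments.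
Unset Strict Implicit.
Unset Printing Implicit Defensive.

Import Order.TTheory GRing.Theory Num.Theory.
Import numFieldNormedType.Exports.

Local Open Scope classical_set_scope.
Local Open Scope ring_scope.

Section Geometry.
Context {R : realType}.
Implicit Types u v n X P E : 'rV[R]_3.

Definition dotv u v : R := \sum_(i < 3) u 0 i * v 0 i.

(* Euclidean norm; the library norm `|u| on row vectors is the sup norm. *)
Definition enorm u : R := Num.sqrt (dotv u u).

(* The additions in 'I_3 are modulo 3. *)
Definition crossv u v : 'rV[R]_3 :=
  \row_(i < 3) (u 0 (i + 1) * v 0 (i + 2%:R) - u 0 (i + 2%:R) * v 0 (i + 1)).

Definition angle u v : R := acos (dotv u v / (enorm u * enorm v)).

Definition on_sphere (rho : R) X := enorm X = rho.

(* n is a unit normal of an oriented great circle through P and E.  When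
   0 < angle P E < pi the last clause forces n = n_GC; when P = - E it is void
   and n ranges over the normals of all the great circles through P and E. *)
Definition gc_normal (rho : R) P E n :=
  [/\ enorm n = 1, dotv n P = 0, dotv n E = 0
    & sin (angle P E) *: n = (rho ^+ 2)^-1 *: crossv P E].

Definition gc_tangent (rho : R) n X : 'rV[R]_3 := rho^-1 *: crossv n X.

Definition velocity (rho : R) n X (speed heading : R) : 'rV[R]_3 :=
  speed *: (cos heading *: gc_tangent rho n X + sin heading *: n).

End Geometry.

Section Game.
Context {R : realType}.
Implicit Types (rho vP mu h : R) (n : 'rV[R]_3).

Definition heading_range : set R := [set u | 0 <= u < pi *+ 2].

Definition speed_range vP mu : set R := [set v | 0 <= v <= mu * vP].

(* A strategy prescribes an action from the time and the positions P and E.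
   Dependence on the time lets every history of actions of a player, however
   generated, be realized by a strategy.

   The action of P is (n, u_P).  Off the antipodal states n is forced to be
   n_GC; at an antipodal state u_P = 0 and n encodes the direction of motion
   selected by P.  The action of E is (v_E, u_E), its heading being measured
   from the great circle of P's action, which E does not observe. *)
Definition pursuer_strategy := R -> 'rV[R]_3 -> 'rV[R]_3 -> 'rV[R]_3 * R.
Definition evader_strategy := R -> 'rV[R]_3 -> 'rV[R]_3 -> R * R.

Definition pursuer_admissible rho (sP : pursuer_strategy) :=
  forall t P E, on_sphere rho P -> on_sphere rho E -> 0 < angle P E ->
    [/\ gc_normal rho P E (sP t P E).1, heading_range (sP t P E).2
      & angle P E = pi -> (sP t P E).2 = 0].

Definition evader_admissible rho vP mu (sE : evader_strategy) :=
  forall t P E, on_sphere rho P -> on_sphere rho E -> 0 < angle P E ->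
    speed_range vP mu (sE t P E).1 /\ heading_range (sE t P E).2.

(* +oo when there is no capture *)
Definition capture_time (P E : R -> 'rV[R]_3) : \bar R :=
  ereal_inf [set t%:E | t in [set t : R | 0 <= t /\ P t = E t]].

(* Trajectories generated by a pair of strategies: Caratheodory solutions,
   absolute continuity being stated as Lipschitz continuity because the speeds
   are bounded.  The equations of motion hold until capture; what the
   trajectories do afterwards is irrelevant. *)
Definition play rho vP (sP : pursuer_strategy) (sE : evader_strategy)
    (P0 E0 : 'rV[R]_3) (P E : R -> 'rV[R]_3) :=
  [/\ P 0 = P0 /\ E 0 = E0,
      (forall t, 0 <= t -> on_sphere rho (P t) /\ on_sphere rho (E t)),
      [lipschitz P t | t in [set t : R | 0 <= t]],
      [lipschitz E t | t in [set t : R | 0 <= t]]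
    & {ae @lebesgue_measure R, forall t : R,
        0 <= t -> (t%:E < capture_time P E)%E ->
        let: (n, uP) := sP t (P t) (E t) in
        let: (vE, uE) := sE t (P t) (E t) in
        is_derive t 1 P (velocity rho n (P t) vP uP) /\
        is_derive t 1 E (velocity rho n (E t) vE uE)}].

Definition equilibrium rho vP mu (sP : pursuer_strategy) (sE : evader_strategy)
    (P0 E0 : 'rV[R]_3) :=
  [/\ pursuer_admissible rho sP, evader_admissible rho vP mu sE
    & exists tau : \bar R,
      [/\ exists P E, play rho vP sP sE P0 E0 P E,
          (forall P E, play rho vP sP sE P0 E0 P E -> capture_time P E = tau),
          (forall sE', evader_admissible rho vP mu sE' ->
            forall P E, play rho vP sP sE' P0 E0 P E ->
              (capture_time P E <= tau)%E)
        & (forall sP', pursuer_admissible rho sP' ->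
            forall P E, play rho vP sP' sE P0 E0 P E ->
              (tau <= capture_time P E)%E)]].

(* No condition is needed at antipodal states, where admissibility leaves the
   direction of motion n free. *)
Definition pursuer_star rho (sP : pursuer_strategy) :=
  pursuer_admissible rho sP /\
  forall t P E, on_sphere rho P -> on_sphere rho E -> 0 < angle P E < pi ->
    (sP t P E).2 = 0.

Definition evader_star rho vP mu (sE : evader_strategy) :=
  evader_admissible rho vP mu sE /\
  forall t P E, on_sphere rho P -> on_sphere rho E ->
    (0 < angle P E < pi -> sE t P E = (mu * vP, 0)) /\
    (angle P E = pi -> (sE t P E).1 = 0).

Definition value rho vP mu (alpha : R) : R := rho * alpha / ((1 - mu) * vP).

(* Angular distance after a hold of length h that starts at angle pi with
   u_P = 0 and evader action (vE, uE), from
   alpha' = vE / rho * cos uE - vP / rho * cos u_P. *)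
Definition angle_hold rho vP (vE uE h : R) : R :=
  pi + vE * h * cos uE / rho - vP * h / rho.

Definition rate_of_loss rho vP mu (vE uE : R) : R :=
  - lim ((value rho vP mu (angle_hold rho vP vE uE h) - value rho vP mu pi + h)
         / h @[h --> 0^'+]).

Definition max_over (A : set R) (f : R -> R) (m : R) :=
  (exists2 x, A x & f x = m) /\ forall x, A x -> f x <= m.

Definition min_over (A : set R) (f : R -> R) (m : R) :=
  (exists2 x, A x & f x = m) /\ forall x, A x -> m <= f x.

(* (v, u) attains min over A, max over B of L, that value being a saddle value
   (min max = max min). *)
Definition attains_saddle_value (A B : set R) (L : R -> R -> R) (v u : R) :=
  [/\ A v, B u & exists m : R,
    [/\ exists2 M : R -> R,
          (forall x, A x -> max_over B (L x) (M x)) & min_over A M m /\ M v = m,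
        exists2 N : R -> R,
          (forall y, B y -> min_over A (L^~ y) (N y)) & max_over B N m
      & L v u = m]].

(* Commitment to (n, u_P = 0), resp. (vE, uE), on [0, h[. *)
Definition pursuer_hold h n (sP : pursuer_strategy) : pursuer_strategy :=
  fun t P E => if t < h then (n, 0) else sP t P E.

Definition evader_hold h (vE uE : R) (sE : evader_strategy) : evader_strategy :=
  fun t P E => if t < h then (vE, uE) else sE t P E.

End Game.

(* Main.v *)
(* For a play, let alpha be the angle between P and E.  As long as 0 < alpha < pi,
   P . E = rho^2 cos alpha gives alpha' = (v_E cos u_E - v_P cos u_P) / rho for
   almost every time, so u_P = 0 forces alpha' <= -(1 - mu) v_P / rho whatever E
   does, and (v_E, u_E) = (mu v_P, 0) forces alpha' >= -(1 - mu) v_P / rho whatever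
   P does.  Trajectories are only Lipschitz, so these bounds are integrated by a
   covering argument; together they give the saddle point with value
   rho alpha / ((1 - mu) v_P).

   At alpha = pi the rate of loss is (mu v_P - v_E cos u_E) / ((1 - mu) v_P), whose
   saddle value mu / (1 - mu) is attained exactly at v_E = 0.  With v_E = 0 during
   the hold, P rotates about n and alpha(h) = pi - v_P h / rho, so that
   V(pi) - tau = V(pi) - h - V(alpha(h)) = mu h / (1 - mu). *)
Require Import Defs.
From HB Require Import structures.
From mathcomp Require Import all_boot all_order all_algebra.
From mathcomp Require Import all_classical all_reals all_analysis.
From mathcomp Require Import ring lra.
Import Order.TTheory GRing.Theory Num.Theory.
Import numFieldNormedType.Exports.
Local Open Scope classical_set_scope.
Local Open Scope ring_scope.

Set Implicit Arguments.
Unset Strict Implicit.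
Unset Printing Implicit Defensive.

(** * Lipschitz functions and their derivatives *)

(** Strategies are arbitrary functions of time and positions, so no general theorem gives existence
    or uniqueness of plays. Existence is shown by exhibiting explicit rotations, and capture times
    are bounded on every play, whatever its number. A second obstacle is the angle: [acos] is not
    Lipschitz at -1 and 1, so neither is the angle at capture or at antipodal states. Comparisons
    with a linear function of time therefore go by induction along the real line, where the local
    step uses the angle strictly between 0 and [pi] and the passage to the limit uses its cosine,
    which is Lipschitz everywhere. Finally, the equations of motion are available only before
    capture, so a lower bound on the angle must at the same time exclude an earlier capture. *)

(** The supremum of the times up to which [Q] holds throughout is itself such a time, and it cannot
    lie before [b]. Both inductive hypotheses see the whole past, which is where the absence of
    capture up to [t] will come from. *)
Lemma real_induction (R : realType) (a b : R) (Q : R -> Prop) :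
  Q a ->
  (forall t, a < t <= b -> (forall s, a <= s < t -> Q s) -> Q t) ->
  (forall t, a <= t < b -> (forall s, a <= s <= t -> Q s) ->
    exists2 d, 0 < d & forall s, t < s < t + d -> s <= b -> Q s) ->
  forall t, a <= t <= b -> Q t.
Proof.
move=> Qa Qlim Qstep t0 /andP[at0 t0b].
pose A := [set t | a <= t <= b /\ forall s, a <= s <= t -> Q s].
have ab : a <= b by exact: le_trans t0b.
have Aa : A a.
  split=> [|s sa]; first by rewrite lexx.
  by have -> : s = a by apply/eqP; rewrite eq_le andbC.
have supA : has_sup A by split; [exists a|exists b => t [/andP[]]].
have asup : a <= sup A by apply: ub_le_sup => //; case: supA.
have supb : sup A <= b by apply: ge_sup; [exists a|move=> t [/andP[]]].
have Qlt s : a <= s < sup A -> Q s.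
  case/andP=> as_ ssup; have ds : 0 < sup A - s by rewrite subr_gt0.
  have [t [_ Qt] st] := sup_adherent ds supA.
  apply: Qt; rewrite as_ ltW//; lra.
have Qsup : Q (sup A).
  have [<-//|nasup] := eqVneq a (sup A).
  by apply: Qlim => //; rewrite supb lt_neqAle nasup asup.
have Qle s : a <= s <= sup A -> Q s.
  case/andP=> as_; rewrite le_eqVlt => /orP[/eqP->//|ssup].
  by apply: Qlt; rewrite as_.
suff bsup : b <= sup A by apply: Qle; rewrite at0 (le_trans t0b).
rewrite leNgt; apply/negP => supltb.
have [|d d0 Qd] := Qstep _ _ Qle; first by rewrite asup.
pose u := Num.min b (sup A + d / 2).
have supu : sup A < u by rewrite lt_min supltb/=; lra.
have ub : u <= b by rewrite ge_min lexx.
have ud : u < sup A + d by rewrite gt_min; apply/orP; right; lra.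
have : A u.
  split=> [|s /andP[as_ su]]; first by rewrite ub andbT; lra.
  have [ssup|sups] := leP s (sup A); first by apply: Qle; rewrite as_.
  by apply: Qd; [rewrite sups/=; lra|exact: le_trans ub].
move/(ub_le_sup supA.2); lra.
Qed.

Lemma is_derive_le_near (R : realType) (f : R -> R) (t d c e : R) :
  is_derive t 1 f d -> d <= c -> 0 < e ->
  exists2 r, 0 < r &
    forall s, t < s < t + r -> f s - f t <= (c + e) * (s - t).
Proof.
move=> [fd fd'] dc e0.
have := fd; rewrite /derivable -/(derive f t 1) => /cvg_ex[/= l].
move=> fl; have ld : l = d by rewrite -fd'; apply/esym/cvg_lim.
move/cvgrPdist_lt : fl => /(_ e e0) [/= r r0 H].
exists r => // s /andP[ts sr].
have st0 : 0 < s - t by rewrite subr_gt0.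
have := H (s - t); rewrite /ball_/= sub0r normrN gtr0_norm//.
have sr' : s - t < r by lra.
move=> /(_ sr' (lt0r_neq0 st0)).
rewrite [_ *: 1]mulr1 subrK => Hs.
have {Hs} : (s - t)^-1 *: (f s - f t) < c + e.
  have := ler_norm (- (l - (s - t)^-1 *: (f s - f t))); rewrite normrN; lra.
by rewrite /GRing.scale/= mulrC ltr_pdivrMr// => /ltW.
Qed.

(* Cover the exceptional null set by an open set U of measure at most e and let
   m t be the measure of U on ]a, t].  Then f t - (c + e) (t - a) - (K + |c|) m t
   does not increase: on U because m grows with slope 1, elsewhere because of
   the derivative. *)
Lemma ae_derive_le (R : realType) (f : R -> R) (a b K c : R) :
  a <= b ->
  (forall s t, a <= s -> s <= t -> t <= b -> `|f t - f s| <= K * (t - s)) ->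
  {ae @lebesgue_measure R, forall t, a < t < b ->
    exists2 d, is_derive t 1 f d & d <= c} ->
  f b - f a <= c * (b - a).
Proof.
move=> ab fK [N [mN N0 goodN]].
have [ab'|ba] := ltP a b; last first.
  have -> : b = a by apply/eqP; rewrite eq_le ab ba.
  by rewrite !subrr mulr0.
have K0 : 0 <= K.
  have := fK a b (lexx _) ab (lexx _); move=> /(le_trans (normr_ge0 _)).
  by rewrite pmulr_lge0// subr_gt0.
pose mu : {measure set (measurableTypeR R) -> \bar R} := @lebesgue_measure R.
have main e : 0 < e -> f b - f a <= (c + e) * (b - a) + (K + `|c|) * e.
  move=> e0.
  (* The derivative is known only on the open interval, so its left end is added to the exceptional
     points. *)
  pose N' := N `|` [set a].
  have mN' : measurable N' by exact: measurableU.
  have N'0 : mu N' = 0%E.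
    by rewrite /N' measureU0//; exact: lebesgue_measure_set1.
  have [|U [oU N'U]] := @lebesgue_regularity_outer R N' e mN' _ e0.
    by rewrite [X in (X < _)%E]N'0.
  rewrite -/mu => Ue.
  have mU : measurable U by exact: measurable_realfun.open_measurable.
  have {}Ue : (mu U < e%:E)%E.
    have : (mu U <= mu (U `\` N') + mu N')%E.
      have -> : (mu U = mu ((U `\` N') `|` N'))%E.
        by rewrite setDKU.
      rewrite measureU//; first exact: measurableD.
      by apply/seteqP; split=> x //= -[[_ ?]].
    by rewrite N'0 adde0 => /le_lt_trans; apply.
  pose m t := fine (mu (U `&` `]a, t]%classic)).
  have mUI (s t : R) : measurable (U `&` `]s, t]%classic) by exact: measurableI.
  have fin (s t : R) : (mu (U `&` `]s, t]%classic) \is a fin_num).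
    rewrite ge0_fin_numE//; apply: le_lt_trans (lt_trans Ue (ltry e)).
    apply: le_measure; [by rewrite inE; exact: mUI|by rewrite inE|exact: subIsetl].
  have mD s t : a <= s -> s <= t ->
      m t = m s + fine (mu (U `&` `]s, t]%classic)).
    move=> as_ st; rewrite /m -fineD// -measureU//.
    - rewrite -setIUr; congr (fine (mu (_ `&` _))).
      by rewrite -itv_bndbnd_setU// bnd_simp.
    - exact: mUI.
    - exact: mUI.
    apply/seteqP; split=> x //= -[[_ +] [_ +]].
    rewrite !in_itv/= => /andP[_ xs] /andP[sx _]; lra.
  have m_nd s t : a <= s -> s <= t -> m s <= m t.
    by move=> as_ st; rewrite (mD s t)// lerDl fine_ge0.
  have mU_eq s t : a <= s -> s <= t -> `]s, t]%classic `<=` U ->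
      m t = m s + (t - s).
    move=> as_ st sU; rewrite (mD s t)//; congr (_ + _).
    rewrite setIidr// [mu _](lebesgue_measure_itv `]s, t]%R)/= lte_fin.
    have [stl|] := ltP s t; first by rewrite -EFinD.
    move=> ts; have -> : t = s by apply/eqP; rewrite eq_le st ts.
    by rewrite subrr.
  have mb : m b <= e.
    rewrite -lee_fin fineK//; apply: le_trans (ltW Ue).
    apply: le_measure; [by rewrite inE; exact: mUI|by rewrite inE|exact: subIsetl].
  have nc0 := normr_ge0 c; have c_n : - c <= `|c| by rewrite -normrN ler_norm.
  suff H : f b - f a <= (c + e) * (b - a) + (K + `|c|) * m b.
    by apply: (le_trans H); rewrite lerD2l ler_wpM2l// addr_ge0.
  have := @real_induction R a b
    (fun t => f t - f a <= (c + e) * (t - a) + (K + `|c|) * m t).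
  apply => //; last by rewrite ab lexx.
  - rewrite !subrr mulr0 add0r mulr_ge0 ?addr_ge0// /m fine_ge0//.
  - move=> t /andP[at_ tb] IH.
    rewrite -subr_ge0 leNgt; apply/negP => neg.
    set x := (X in X < 0) in neg.
    (* A failure by [- x] at [t] would already occur at [t - r] once [r * L < - x]: [f] changes by
       at most [K * r], and [m] is nondecreasing. *)
    pose L := K + `|c| + e + 1.
    have L0 : 0 < L by rewrite /L; lra.
    pose r := Num.min ((t - a) / 2) (- x / L / 2).
    have xL : 0 < - x / L by rewrite divr_gt0// oppr_gt0.
    have r0 : 0 < r by rewrite lt_min; apply/andP; split; lra.
    have ra : r <= (t - a) / 2 by rewrite ge_min lexx.
    have rx : r * L < - x.
      rewrite -ltr_pdivlMr//; apply: (@le_lt_trans _ _ (- x / L / 2)); last lra.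
      by rewrite ge_min lexx orbT.
    have ats : a <= t - r < t by apply/andP; split; lra.
    have := IH _ ats; have := fK (t - r) t; case/andP: ats => ats tst.
    move=> /(_ ats (ltW tst) tb) /(le_trans (ler_norm _)) ft fs.
    have mm := m_nd _ _ ats (ltW tst).
    have mm' : (K + `|c|) * m (t - r) <= (K + `|c|) * m t.
      by rewrite ler_wpM2l// addr_ge0.
    have rnc : r * - `|c| <= r * c.
      by rewrite ler_wpM2l// ?(ltW r0)//; rewrite lerNl.
    move: ft fs rx; rewrite /x /L; nra.
  - move=> t /andP[at_ tb] IH; have Qt := IH t; rewrite at_ lexx in Qt.
    have {Qt} := Qt isT => Qt.
    have [Ut|nUt] := pselect (U t).
      have /nbhs_ballP[r /= r0 rU] := open_nbhs_nbhs (conj oU Ut).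
      exists r => // s /andP[ts sr] sb.
      have st0 : t <= s by exact: ltW.
      have -> : m s = m t + (s - t).
        apply: mU_eq => // y /=; rewrite in_itv/= => /andP[ty ys].
        by apply: rU; rewrite /ball/= ltr_norml; lra.
      have := fK t s at_ st0 sb => /(le_trans (ler_norm _)) H.
      (* This explains the weight [K + |c|] of [m]: [K] pays for the growth of [f] and [|c|] for a
         negative [c]. *)
      have H2 : - c * (s - t) <= `|c| * (s - t).
        by rewrite ler_wpM2r// subr_ge0.
      have H3 : 0 <= e * (s - t) by rewrite mulr_ge0 ?subr_ge0// ltW.
      move: Qt; lra.
    have tN : ~ N' t by move=> /N'U.
    have ta : a < t.
      rewrite lt_neqAle at_ andbT; apply/eqP => ta; apply: tN; right.
      by rewrite /= ta.
    have : ~ ~ (a < t < b -> exists2 d, is_derive t 1 f d & d <= c).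
      by move=> H; apply: tN; left; apply: goodN.
    move=> /contrapT []; first by rewrite ta.
    move=> d fd dc; have [r r0 H] := @is_derive_le_near R f t d c e fd dc e0.
    exists r => // s /andP[ts sr] sb.
    have := H s; rewrite ts sr => /(_ isT) fts.
    have mm : (K + `|c|) * m t <= (K + `|c|) * m s.
      by rewrite ler_wpM2l ?addr_ge0// m_nd// ltW.
    move: Qt; lra.
rewrite leNgt; apply/negP => lt.
(* The bound [main] exceeds the desired one by [e * ((b - a) + (K + |c|))], which is less than [x]
   for [e = x / L]. *)
pose L := (b - a) + (K + `|c|) + 1.
have L0 : 0 < L by rewrite /L; have := normr_ge0 c; lra.
pose x := f b - f a - c * (b - a).
have x0 : 0 < x by rewrite subr_gt0.
have := main (x / L); rewrite divr_gt0// => /(_ isT) H.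
have : x / L * L = x by rewrite divfK// gt_eqF.
have : 0 < x / L by rewrite divr_gt0.
move: H; rewrite /L /x; lra.
Qed.

(** * Vectors of R^3 and great circles *)

Section Vectors.
Variable R : realType.
Implicit Types (u v w n P E : 'rV[R]_3) (a b rho : R).

Lemma dotvE u v :
  dotv u v = u 0 0 * v 0 0 + u 0 1 * v 0 1 + u 0 2%:R * v 0 2%:R.
Proof.
rewrite /dotv !big_ord_recl big_ord0 addr0 -addrA.
by congr (_ * _ + (_ * _ + _ * _)); congr (_ 0 _); exact: val_inj.
Qed.

Lemma crossvE0 u v : crossv u v 0 0 = u 0 1 * v 0 2%:R - u 0 2%:R * v 0 1.
Proof. by rewrite mxE; congr (_ * _ - _ * _); congr (_ 0 _); exact: val_inj. Qed.

Lemma crossvE1 u v : crossv u v 0 1 = u 0 2%:R * v 0 0 - u 0 0 * v 0 2%:R.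
Proof. by rewrite mxE; congr (_ * _ - _ * _); congr (_ 0 _); exact: val_inj. Qed.

Lemma crossvE2 u v : crossv u v 0 2%:R = u 0 0 * v 0 1 - u 0 1 * v 0 0.
Proof. by rewrite mxE; congr (_ * _ - _ * _); congr (_ 0 _); exact: val_inj. Qed.

Lemma row3P u v :
  u 0 0 = v 0 0 -> u 0 1 = v 0 1 -> u 0 2%:R = v 0 2%:R -> u = v.
Proof.
move=> h0 h1 h2; apply/rowP => -[[|[|[|//]]]] i3.
- by rewrite (_ : Ordinal i3 = 0)//; exact: val_inj.
- by rewrite (_ : Ordinal i3 = 1)//; exact: val_inj.
- by rewrite (_ : Ordinal i3 = 2%:R)//; exact: val_inj.
Qed.

Lemma rowDE u v i j : (u + v) i j = u i j + v i j. Proof. by rewrite mxE. Qed.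

Lemma rowNE u i j : (- u) i j = - u i j. Proof. by rewrite mxE. Qed.

Lemma rowZE a u i j : (a *: u) i j = a * u i j. Proof. by rewrite mxE. Qed.

Lemma row0E i j : (0 : 'rV[R]_3) i j = 0. Proof. by rewrite mxE. Qed.

(* mxE is not used here: it would also unfold crossv. *)
Definition coordE :=
  (crossvE0, crossvE1, crossvE2, dotvE, rowDE, rowNE, rowZE, row0E).

Lemma dotvC u v : dotv u v = dotv v u.
Proof. by rewrite !coordE; ring. Qed.

Lemma dotvDl u v w : dotv (u + v) w = dotv u w + dotv v w.
Proof. by rewrite !coordE; ring. Qed.

Lemma dotvZl a u w : dotv (a *: u) w = a * dotv u w.
Proof. by rewrite !coordE; ring. Qed.

Lemma dotvDr u v w : dotv w (u + v) = dotv w u + dotv w v.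
Proof. by rewrite !coordE; ring. Qed.

Lemma dotvZr a u w : dotv w (a *: u) = a * dotv w u.
Proof. by rewrite !coordE; ring. Qed.

Lemma dotvBl u v w : dotv (u - v) w = dotv u w - dotv v w.
Proof. by rewrite !coordE; ring. Qed.

Lemma dotvBr u v w : dotv w (u - v) = dotv w u - dotv w v.
Proof. by rewrite !coordE; ring. Qed.

Lemma dotv_crossv u v w : dotv (crossv u v) w = dotv u (crossv v w).
Proof. by rewrite !coordE; ring. Qed.

Lemma crossvN u v : crossv u v = - crossv v u.
Proof. by apply: row3P; rewrite !coordE; ring. Qed.

Lemma crossvDr u v w : crossv u (v + w) = crossv u v + crossv u w.
Proof. by apply: row3P; rewrite !coordE; ring. Qed.

Lemma crossvZr a u v : crossv u (a *: v) = a *: crossv u v.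
Proof. by apply: row3P; rewrite !coordE; ring. Qed.

Lemma crossvZl a u v : crossv (a *: u) v = a *: crossv u v.
Proof. by apply: row3P; rewrite !coordE; ring. Qed.

Lemma crossv_crossvl u v w :
  crossv (crossv u v) w = dotv u w *: v - dotv v w *: u.
Proof. by apply: row3P; rewrite !coordE; ring. Qed.

Lemma crossv_crossvr u v w :
  crossv u (crossv v w) = dotv u w *: v - dotv u v *: w.
Proof. by apply: row3P; rewrite !coordE; ring. Qed.

Lemma dotvv_ge0 u : 0 <= dotv u u.
Proof. by rewrite dotvE !addr_ge0// -expr2 sqr_ge0. Qed.

Lemma dotvv_eq0 u : dotv u u = 0 -> u = 0.
Proof.
rewrite dotvE => h; have := sqr_ge0 (u 0 0); have := sqr_ge0 (u 0 1).
have := sqr_ge0 (u 0 2%:R); rewrite !expr2 => h2 h1 h0.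
have z x : x * x = 0 -> x = 0 :> R by move/eqP; rewrite mulf_eq0 orbb => /eqP.
by apply: row3P; rewrite row0E; apply: z; lra.
Qed.

(** Lagrange's identity; since its left side is nonnegative, it yields the Cauchy-Schwarz bound on
    the sphere. *)
Lemma dotv_crossv_sqr u v :
  dotv (crossv u v) (crossv u v) = dotv u u * dotv v v - dotv u v ^+ 2.
Proof. by rewrite !coordE; ring. Qed.

Lemma enorm_eq a u : 0 <= a -> (enorm u = a) <-> (dotv u u = a ^+ 2).
Proof.
move=> a0; rewrite /enorm; split=> [<-|->].
  by rewrite sqr_sqrtr// dotvv_ge0.
by rewrite sqrtr_sqr ger0_norm.
Qed.

End Vectors.

Section Sphere.
Variables (R : realType) (rho : R).
Hypothesis rho_gt0 : 0 < rho.
Implicit Types (u v w n P E : 'rV[R]_3) (a b : R).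

Let rho2_gt0 : 0 < rho ^+ 2. Proof. exact: exprn_gt0. Qed.

Let rho2_neq0 : rho ^+ 2 != 0. Proof. by rewrite gt_eqF. Qed.

Lemma dotv_sphere P : on_sphere rho P -> dotv P P = rho ^+ 2.
Proof. by move=> h; apply/(enorm_eq _ (ltW rho_gt0)). Qed.

Lemma angle_sphere P E : on_sphere rho P -> on_sphere rho E ->
  angle P E = acos (dotv P E / rho ^+ 2).
Proof. by move=> hP hE; rewrite /angle hP hE expr2. Qed.

Lemma dotv_sphere_bound P E : on_sphere rho P -> on_sphere rho E ->
  -1 <= dotv P E / rho ^+ 2 <= 1.
Proof.
move=> hP hE; rewrite -ler_norml normf_div (gtr0_norm rho2_gt0).
rewrite ler_pdivrMr// mul1r -(@ler_pXn2r _ 2)// ?nnegrE ?sqr_ge0//.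
have := dotvv_ge0 (crossv P E); rewrite dotv_crossv_sqr !dotv_sphere//.
by rewrite subr_ge0 real_normK ?num_real// -expr2.
Qed.

Lemma cos_angle P E : on_sphere rho P -> on_sphere rho E ->
  cos (angle P E) = dotv P E / rho ^+ 2.
Proof.
move=> hP hE; rewrite angle_sphere// acosK// in_itv/=.
exact: dotv_sphere_bound.
Qed.

Lemma angle_range P E : on_sphere rho P -> on_sphere rho E ->
  0 <= angle P E <= pi.
Proof.
move=> hP hE; have h := dotv_sphere_bound hP hE.
by rewrite angle_sphere// acos_ge0// acos_lepi.
Qed.

Lemma dotv_angle P E : on_sphere rho P -> on_sphere rho E ->
  dotv P E = rho ^+ 2 * cos (angle P E).
Proof. by move=> hP hE; rewrite cos_angle// mulrC divfK. Qed.

Lemma sphere_eq P E : on_sphere rho P -> on_sphere rho E ->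
  dotv P E = rho ^+ 2 -> P = E.
Proof.
move=> hP hE h; apply/subr0_eq/dotvv_eq0.
by rewrite !(dotvBl, dotvBr) (dotvC E P) h !dotv_sphere//; ring.
Qed.

Lemma angle_eq0 P E : on_sphere rho P -> on_sphere rho E ->
  (angle P E = 0) <-> (P = E).
Proof.
move=> hP hE; split=> [h|->].
  by apply: sphere_eq => //; rewrite dotv_angle// h cos0 mulr1.
by rewrite angle_sphere// dotv_sphere// divff// acos1.
Qed.

Lemma angle_gt0 P E : on_sphere rho P -> on_sphere rho E ->
  (0 < angle P E) <-> (P <> E).
Proof.
move=> hP hE; have /andP[h0 _] := angle_range hP hE.
rewrite lt_neqAle h0 andbT eq_sym; split=> [/eqP h /(angle_eq0 hP hE)//|h].
by apply/eqP => /(angle_eq0 hP hE).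
Qed.

Lemma coord_sphere P i : on_sphere rho P -> `|P 0 i| <= rho.
Proof.
move=> hP; rewrite -(@ler_pXn2r _ 2)// ?nnegrE ?(ltW rho_gt0)//.
rewrite real_normK ?num_real// -(dotv_sphere hP) /dotv (bigD1 i)//= -expr2.
by rewrite lerDl sumr_ge0// => j _; rewrite -expr2 sqr_ge0.
Qed.

Section GreatCircle.
Variables (n P : 'rV[R]_3).
Hypotheses (nn : dotv n n = 1) (nP : dotv n P = 0) (PP : dotv P P = rho ^+ 2).

(** The rotation of [P] about the axis [n] by the angle [a]: Rodrigues' formula, whose axial term
    vanishes because [n] is orthogonal to [P]. *)
Definition gc_curve (a : R) : 'rV[R]_3 := cos a *: P + sin a *: crossv n P.

Lemma gc_curve0 : gc_curve 0 = P.
Proof. by rewrite /gc_curve cos0 sin0 scale0r addr0 scale1r. Qed.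

Lemma dotv_gc_curve a b :
  dotv (gc_curve a) (gc_curve b) = rho ^+ 2 * cos (b - a).
Proof.
have h : dotv P (crossv n P) = 0 by rewrite !coordE; ring.
have h2 : dotv (crossv n P) (crossv n P) = rho ^+ 2.
  by rewrite dotv_crossv_sqr nn nP PP; ring.
rewrite /gc_curve !(dotvDl, dotvDr, dotvZl, dotvZr) (dotvC (crossv n P) P).
by rewrite h h2 PP cosB; ring.
Qed.

Lemma crossv_gc_curve a b :
  crossv (gc_curve a) (gc_curve b) = (rho ^+ 2 * sin (b - a)) *: n.
Proof.
have h : crossv P (crossv n P) = rho ^+ 2 *: n.
  by rewrite crossv_crossvr PP (dotvC P n) nP scale0r subr0.
have -> : crossv (gc_curve a) (gc_curve b) =
    (cos a * sin b - sin a * cos b) *: crossv P (crossv n P).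
  by apply: row3P; rewrite !coordE; ring.
by rewrite h scalerA sinB; congr (_ *: _); ring.
Qed.

Lemma crossv_n_gc_curve a :
  crossv n (gc_curve a) = - sin a *: P + cos a *: crossv n P.
Proof.
rewrite /gc_curve crossvDr !crossvZr crossv_crossvr nP nn scale0r sub0r scale1r.
by rewrite scalerN scaleNr addrC.
Qed.

Lemma on_sphere_gc_curve a : on_sphere rho (gc_curve a).
Proof.
by apply/enorm_eq; rewrite ?ltW// dotv_gc_curve subrr cos0 mulr1.
Qed.

Lemma angle_gc_curve a b : 0 <= b - a <= pi ->
  angle (gc_curve a) (gc_curve b) = b - a.
Proof.
move=> h; rewrite angle_sphere; [|exact: on_sphere_gc_curve..].
by rewrite dotv_gc_curve mulrAC divff// mul1r cosK// in_itv.
Qed.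

(** Serves to recognize the normal prescribed by the pursuer's strategy as the axis of the rotation;
    the sine of the angle is nonzero and can be cancelled. *)
Lemma gc_normal_gc_curve a b m : 0 < b - a < pi ->
  gc_normal rho (gc_curve a) (gc_curve b) m -> m = n.
Proof.
move=> /andP[h0 h1] [_ _ _]; rewrite angle_gc_curve ?(ltW h0) ?(ltW h1)//.
rewrite crossv_gc_curve scalerA mulrA mulVf// mul1r.
by apply: scalerI; rewrite gt_eqF// sin_gt0_pi// h0.
Qed.

End GreatCircle.

(** [n] enters only through [sin (angle P E) *: n], so antipodal points are included. The double
    product of [P x E] with [P] gives back [E] up to a multiple of [P], which the cosine term
    compensates. *)
Lemma gc_normal_curve n P E : on_sphere rho P -> on_sphere rho E ->
  gc_normal rho P E n -> E = gc_curve n P (angle P E).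
Proof.
move=> hP hE [_ nP _ h]; rewrite /gc_curve -crossvZl h crossvZl.
rewrite crossv_crossvl dotv_sphere// (dotvC E P) scalerBr !scalerA mulVf//.
by rewrite scale1r cos_angle// [_^-1 * _]mulrC addrC subrK.
Qed.

End Sphere.

(** * Derivatives of curves in R^3 *)

Section CurveCalculus.
Variable R : realType.
Implicit Types (P E : R -> 'rV[R]_3) (p e n : 'rV[R]_3) (t rho : R).

Lemma is_derive_coord P t p i : is_derive t 1 P p ->
  is_derive t 1 (fun s => P s 0 i) (p 0 i).
Proof.
move=> [dP <-]; have h := (derivable_mxP P t 1).1 dP 0 i.
by rewrite derive_mx// mxE; exact: DeriveDef.
Qed.

Lemma is_derive_rV P t p : (forall i, is_derive t 1 (fun s => P s 0 i) (p 0 i)) ->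
  is_derive t 1 P p.
Proof.
move=> h; have dP : derivable P t 1.
  by apply/derivable_mxP => j i; rewrite (ord1 j); case: (h i).
apply: DeriveDef => //; rewrite derive_mx//; apply/rowP => i.
by rewrite mxE; case: (h i).
Qed.

Lemma is_derive_dotv P E t p e : is_derive t 1 P p -> is_derive t 1 E e ->
  is_derive t 1 (fun s => dotv (P s) (E s)) (dotv p (E t) + dotv (P t) e).
Proof.
move=> hP hE; have hPi i := is_derive_coord i hP.
have hEi i := is_derive_coord i hE.
have -> : (fun s => dotv (P s) (E s)) =
    \sum_(i < 3) ((fun s => P s 0 i) * (fun s => E s 0 i)).
  by apply/funext => s; rewrite /dotv fct_sumE.
apply: is_derive_eq; rewrite /dotv -big_split/=; apply: eq_bigr => i _.
by rewrite /GRing.scale/=; ring.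
Qed.

End CurveCalculus.

(** * The angular distance *)

Section Angle.
Variables (R : realType) (rho : R).
Hypothesis rho_gt0 : 0 < rho.
Implicit Types (P E : R -> 'rV[R]_3) (n : 'rV[R]_3) (t : R).

(** The velocity components along [n] drop out because [n] is orthogonal to [P] and [E]. The
    tangential ones produce the triple products of [n], [P] and [E], equal to
    [rho ^+ 2 * sin (angle (P t) (E t))] up to sign, and this sine cancels against the derivative of
    [acos]. *)
Lemma angle_is_derive P E t n vP uP vE uE :
  (\near t, on_sphere rho (P t) /\ on_sphere rho (E t)) ->
  gc_normal rho (P t) (E t) n -> 0 < angle (P t) (E t) < pi ->
  is_derive t 1 P (velocity rho n (P t) vP uP) ->
  is_derive t 1 E (velocity rho n (E t) vE uE) ->
  is_derive t 1 (fun s => angle (P s) (E s)) ((vE * cos uE - vP * cos uP) / rho).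
Proof.
move=> nsph [n1 nP nE nPE] /andP[a0 api] dP dE.
have [hP hE] := nbhs_singleton nsph.
have rho0 : rho != 0 by rewrite gt_eqF.
have sa : 0 < sin (angle (P t) (E t)) by rewrite sin_gt0_pi// a0.
have nn : dotv n n = 1 by have := (enorm_eq n ler01).1 n1; rewrite expr1n.
have PE : crossv (P t) (E t) = (rho ^+ 2 * sin (angle (P t) (E t))) *: n.
  by rewrite -scalerA nPE scalerA mulfV ?expf_neq0// scale1r.
have EP : crossv (E t) (P t) = - (rho ^+ 2 * sin (angle (P t) (E t))) *: n.
  by rewrite crossvN PE scaleNr.
have := is_derive_dotv dP dE; rewrite /velocity /gc_tangent.
rewrite !(dotvZl, dotvDl) (dotvC (P t)) !(dotvZl, dotvDl) !dotv_crossv PE EP.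
rewrite !dotvZr nn nE nP; set d := (X in is_derive _ _ _ X) => dd.
have ca := cos_angle rho_gt0 hP hE.
have caB := cos_geN1 (angle (P t) (E t)).
apply: (@near_eq_is_derive _ _ _
  (@acos R \o (fun s => rho ^- 2 *: dotv (P s) (E s)))).
  apply: filterS nsph => s [hPs hEs].
  by rewrite /= (angle_sphere hPs hEs) /GRing.scale/= mulrC.
apply: is_derive_eq.
  apply: is_derive1_comp; apply: is_derive1_acos.
  rewrite /GRing.scale/= mulrC -ca -cospi -[1]cos0.
  rewrite !ltr_cos ?in_itv/= ?lexx ?pi_ge0//.
  - by rewrite api.
  - by rewrite (ltW a0) ltW.
  - by rewrite (ltW a0) ltW.
rewrite /GRing.scale/= [_^-1 * dotv _ _]mulrC -ca.
have -> : Num.sqrt (1 - cos (angle (P t) (E t)) ^+ 2) = sin (angle (P t) (E t)).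
  by rewrite -sin2cos2 sqrtr_sqr gtr0_norm.
by rewrite /d; field; rewrite rho0 gt_eqF.
Qed.

(** Between [x] and [y], [1 - z ^+ 2] is at least the smaller of its two end values, so [q^-1]
    bounds the derivative of [acos] on the whole segment. *)
Lemma acos_lipschitz (q x y : R) : 0 < q ->
  q ^+ 2 <= 1 - x ^+ 2 -> q ^+ 2 <= 1 - y ^+ 2 ->
  `|acos x - acos y| <= q^-1 * `|x - y|.
Proof.
move=> q0; wlog xy : x y / x <= y => [h|qx qy].
  have [xy|/ltW yx] := leP x y; first exact: h.
  by move=> qx qy; rewrite distrC (distrC x); exact: h.
have q20 : 0 < q ^+ 2 by rewrite exprn_gt0.
have qz z : x <= z <= y -> q ^+ 2 <= 1 - z ^+ 2.
  move=> /andP[xz zy]; have [z0|z0] := leP 0 z.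
    have : z ^+ 2 <= y ^+ 2 by rewrite ler_pXn2r ?nnegrE//; exact: le_trans zy.
    lra.
  have : (- z) ^+ 2 <= (- x) ^+ 2 by rewrite ler_pXn2r ?nnegrE//; lra.
  rewrite !sqrrN; lra.
have z1 z : x <= z <= y -> -1 < z < 1.
  by move=> /qz h; apply/andP; split; nra.
rewrite (distrC (acos x)) (distrC x).
have [||z /[!in_itv]/= zxy ->] := @MVT_segment R (@acos R)
    (fun z => - (Num.sqrt (1 - z ^+ 2))^-1) x y xy.
- move=> z; rewrite in_itv/= => /andP[xz zy].
  by apply: is_derive1_acos; apply: z1; rewrite !ltW.
- apply: derivable_within_continuous => z; rewrite in_itv/= => /z1 hz.
  by have [] := is_derive1_acos hz.
have qs : q <= Num.sqrt (1 - z ^+ 2).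
  by rewrite -{1}(ger0_norm (ltW q0)) -sqrtr_sqr ler_wsqrtr// qz.
have s0 : 0 < Num.sqrt (1 - z ^+ 2) by exact: lt_le_trans qs.
rewrite normrM ler_wpM2r// normrN normfV gtr0_norm// lef_pV2 ?posrE//.
Qed.

End Angle.

(** * Capture times from bounds on the angular rate *)

Lemma ler_cos (R : realType) : {in `[0, pi] &, {mono @cos R : x y /~ y <= x}}.
Proof. by move=> x y hx hy; rewrite !leNgt ltr_cos. Qed.

Lemma ae_imply (R : realType) (A B : R -> Prop) :
  (forall x, A x -> B x) -> {ae @lebesgue_measure R, forall x, A x} ->
  {ae @lebesgue_measure R, forall x, B x}.
Proof. by move=> AB; apply: negligibleS; exact: subsetC. Qed.

(** The limit step of the inductions below, applied there to differences of cosines: a function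
    whose fall is controlled by [M] cannot jump down to a negative value at [t]. *)
Lemma lipschitz_ge0_left (R : realType) (f : R -> R) (M t0 t : R) :
  t0 < t -> 0 <= M ->
  (forall s, t0 <= s < t -> f s - f t <= M * (t - s)) ->
  (forall s, t0 <= s < t -> 0 <= f s) -> 0 <= f t.
Proof.
move=> t0t M0 fM f0; rewrite leNgt; apply/negP => ft.
have M1 : 0 < M + 1 by rewrite ltr_pwDr.
pose r := Num.min (t - t0) (- f t / (M + 1)).
have r0 : 0 < r by rewrite lt_min subr_gt0 t0t divr_gt0// oppr_gt0.
have rt : r <= t - t0 by rewrite ge_min lexx.
have rM : r * (M + 1) <= - f t by rewrite -ler_pdivlMr// ge_min lexx orbT.
have st : t0 <= t - r < t by apply/andP; split; lra.
have tr : t - (t - r) = r by ring.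
by have := fM _ st; have := f0 _ st; rewrite tr; lra.
Qed.

Lemma cos_lipschitz (R : realType) (x y : R) : `|cos x - cos y| <= `|x - y|.
Proof.
wlog xy : x y / x <= y => [h|].
  by have [/h//|/ltW/h] := leP x y; rewrite distrC (distrC y).
have [|z _ h] := @MVT_segment R (@cos R) (fun z => - sin z) x y xy.
  by apply: derivable_within_continuous => z _; exact: derivable_cos.
rewrite (distrC (cos x)) (distrC x) h normrM normrN ler_piMl//.
by rewrite ler_norml sin_geN1 sin_le1.
Qed.

Lemma sin_lipschitz (R : realType) (x y : R) : `|sin x - sin y| <= `|x - y|.
Proof.
have := cos_lipschitz (x - pi / 2) (y - pi / 2).
have sc z : cos (z - pi / 2) = sin z :> R.
  by rewrite cosB cos_pihalf sin_pihalf mulr0 add0r mulr1.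
by rewrite !sc opprB addrA subrK.
Qed.

Section CaptureTime.
Variables (R : realType) (rho K : R) (P E : R -> 'rV[R]_3).
Hypotheses (rho_gt0 : 0 < rho) (K_ge0 : 0 <= K).
Hypotheses (sphP : forall t, 0 <= t -> on_sphere rho (P t))
           (sphE : forall t, 0 <= t -> on_sphere rho (E t)).
Hypotheses
  (lipP : forall s t, 0 <= s -> 0 <= t -> `|P s - P t| <= K * `|s - t|)
  (lipE : forall s t, 0 <= s -> 0 <= t -> `|E s - E t| <= K * `|s - t|).
Implicit Types s t : R.

(** The norm of [v] is the sup norm, hence the factor 3 for the three coordinates; it becomes 6 in
    [L], where both factors of the product move. *)
Lemma ler_dotv (u v : 'rV[R]_3) : (forall i, `|u 0 i| <= rho) ->
  `|dotv u v| <= (rho *+ 3) * `|v|.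
Proof.
move=> uM; have -> : rho *+ 3 * `|v| = \sum_(i < 3) rho * `|v|.
  by rewrite sumr_const card_ord mulrnAl.
apply: (le_trans (ler_norm_sum _ _ _)); apply: ler_sum => i _.
rewrite normrM ler_pM//; rewrite [leRHS]/Num.Def.normr/= mx_normrE.
exact: (le_bigmax _ (fun i => `|v i.1 i.2|) (0, i)).
Qed.

Let L := (rho *+ 6) * K.

Lemma dotv_lipschitz s t : 0 <= s -> 0 <= t ->
  `|dotv (P s) (E s) - dotv (P t) (E t)| <= L * `|s - t|.
Proof.
move=> s0 t0.
have -> : dotv (P s) (E s) - dotv (P t) (E t) =
    dotv (E s) (P s - P t) + dotv (P t) (E s - E t).
  by rewrite !dotvBr (dotvC (E s) (P s)) (dotvC (E s) (P t)); ring.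
have hE := ler_dotv (P s - P t) (fun i => coord_sphere rho_gt0 i (sphE s0)).
have hP := ler_dotv (E s - E t) (fun i => coord_sphere rho_gt0 i (sphP t0)).
apply: (le_trans (ler_normD _ _)); apply: (le_trans (lerD hE hP)).
rewrite -mulrDr /L -mulrA.
have -> : rho *+ 6 = rho *+ 3 * 2 by rewrite -mulr_natr -[rho *+ 3]mulr_natr; ring.
rewrite -[leRHS]mulrA ler_wpM2l// ?mulrn_wge0 ?(ltW rho_gt0)// mulr_natl mulr2n.
by apply: lerD; [exact: lipP|exact: lipE].
Qed.

Let rho2_gt0 : 0 < rho ^+ 2. Proof. exact: exprn_gt0. Qed.

(** The cosine of the angle for [0 <= t]. It is Lipschitz even through capture and antipodal states,
    where the angle is not known to be. *)
Let c t := dotv (P t) (E t) / rho ^+ 2.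

Let Lc := L / rho ^+ 2.

Let Lc_ge0 : 0 <= Lc.
Proof. by rewrite divr_ge0 ?mulr_ge0 ?mulrn_wge0 ?(ltW rho_gt0) ?(ltW rho2_gt0). Qed.

Let c_lip s t : 0 <= s -> 0 <= t -> `|c s - c t| <= Lc * `|s - t|.
Proof.
move=> s0 t0; rewrite /c -mulrBl normrM (gtr0_norm (x := _^-1)) ?invr_gt0//.
by rewrite /Lc [leRHS]mulrAC ler_wpM2r ?invr_ge0 ?(ltW rho2_gt0) ?dotv_lipschitz.
Qed.

Let cE t : 0 <= t -> c t = cos (angle (P t) (E t)).
Proof. by move=> t0; rewrite (cos_angle rho_gt0 (sphP t0) (sphE t0)). Qed.

Let range t : 0 <= t -> 0 <= angle (P t) (E t) <= pi.
Proof. by move=> t0; exact: (angle_range rho_gt0 (sphP t0) (sphE t0)). Qed.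

Let angle_eq0 t : 0 <= t -> angle (P t) (E t) = 0 <-> P t = E t.
Proof. by move=> t0; exact: (angle_eq0 rho_gt0 (sphP t0) (sphE t0)). Qed.

Let near_right_lt t x : 0 <= t -> c t < x ->
  exists2 d, 0 < d & forall s, t < s < t + d -> c s < x.
Proof.
move=> t0 ctx; have L1 : 0 < Lc + 1 by rewrite ltr_pwDr.
exists ((x - c t) / (Lc + 1)).
  by apply: divr_gt0 => //; rewrite subr_gt0.
move=> s /andP[ts]; rewrite -ltrBlDl ltr_pdivlMr// => H.
have s0 : 0 <= s by rewrite (le_trans t0)// ltW.
have := le_trans (ler_norm _) (c_lip s0 t0).
by rewrite gtr0_norm ?subr_gt0//; lra.
Qed.

(** The strict inequality comes from continuity: if [P] and [E] differ at [t], then [c] stays below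
    1 up to some [t + d], and the infimum is at least [t + d]. *)
Lemma lt_capture_time t : 0 <= t ->
  (t%:E < capture_time P E)%E <-> forall s, 0 <= s <= t -> P s <> E s.
Proof.
move=> t0; split=> [tlt s /andP[s0 st] PE|h].
  move: tlt; rewrite ltNge => /negP; apply; apply: (@le_trans _ _ s%:E).
    by apply: ereal_inf_lbound; exists s.
  by rewrite lee_fin.
have ct1 : c t < 1.
  rewrite lt_neqAle.
  have /andP[_ ->] := dotv_sphere_bound rho_gt0 (sphP t0) (sphE t0).
  rewrite andbT; apply/eqP => ct; apply: (h t); first by rewrite t0 lexx.
  apply: (sphere_eq rho_gt0 (sphP t0) (sphE t0)).
  by rewrite -[LHS](divfK (lt0r_neq0 rho2_gt0)) -/(c t) ct mul1r.
have [d d0 H] := near_right_lt t0 ct1.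
apply: (@lt_le_trans _ _ (t + d)%:E); first by rewrite lte_fin ltrDl.
apply: le_ereal_inf_tmp => _ [s [s0 PE] <-]; rewrite lee_fin leNgt.
apply/negP => sd; have [st|ts] := leP s t; first by apply: (h s) => //; rewrite s0.
have := H s; rewrite ts sd => /(_ isT).
by rewrite cE// ((angle_eq0 s0).2 PE) cos0 ltxx.
Qed.

Lemma capture_time_gt_near t : (t%:E < capture_time P E)%E ->
  exists2 d, 0 < d & forall s, s < t + d -> (s%:E < capture_time P E)%E.
Proof.
case: (capture_time P E) => [r| |]//; last by exists 1 => // s _; rewrite ltry.
rewrite lte_fin => tr; exists (r - t); first by rewrite subr_gt0.
by move=> s; rewrite lte_fin; lra.
Qed.

(* acos is Lipschitz only away from -1 and 1, so the angle is Lipschitz only near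
   times at which it lies strictly between 0 and pi. *)
Lemma angle_step (sg k d0 t : R) : 0 <= t -> 0 < d0 ->
  0 < angle (P t) (E t) < pi ->
  {ae @lebesgue_measure R, forall s, t < s < t + d0 ->
    0 < angle (P s) (E s) < pi ->
    exists2 d, is_derive s 1 (fun s => angle (P s) (E s)) d & sg * d <= k} ->
  exists2 d, 0 < d & forall s, t < s < t + d ->
    sg * (angle (P s) (E s) - angle (P t) (E t)) <= k * (s - t).
Proof.
move=> t0 d00 /andP[a0 api] aeH.
pose m := sin (angle (P t) (E t)).
have m0 : 0 < m by rewrite sin_gt0_pi// a0.
have m2 : m ^+ 2 = 1 - c t ^+ 2 by rewrite cE// /m sin2cos2.
(* Within time [r] the cosine moves by at most [3 * m ^+ 2 / 8] and its square by at most
   [3 * m ^+ 2 / 4], which leaves [(m / 2) ^+ 2] for the squared sine. The added 1 guards against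
   [Lc = 0]. *)
pose r := m ^+ 2 * 3 / 8 / (Lc + 1).
have Lc1 : 0 < Lc + 1 by rewrite ltr_pwDr.
have r0 : 0 < r by rewrite /r !(divr_gt0, mulr_gt0)// exprn_gt0.
pose d := Num.min d0 r.
have dpos : 0 < d by rewrite lt_min d00.
have cm s : t <= s < t + d -> (m / 2) ^+ 2 <= 1 - c s ^+ 2.
  move=> /andP[ts std]; have s0 : 0 <= s := le_trans t0 ts.
  have csn : `|c s - c t| <= m ^+ 2 * 3 / 8.
    apply: (le_trans (c_lip s0 t0)); rewrite ger0_norm ?subr_ge0//.
    have : s - t <= r by move: std; rewrite -ltrBlDl lt_min => /andP[_ /ltW].
    move=> /(ler_wpM2l (ltW Lc1)); rewrite [X in _ <= X -> _]mulrC divfK ?gt_eqF//.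
    have : 0 <= s - t by rewrite subr_ge0.
    rewrite mulrDl mul1r; lra.
  have b u : 0 <= u -> `|c u| <= 1.
    by move=> u0; rewrite ler_norml dotv_sphere_bound//; [exact: sphP|exact: sphE].
  have : `|c s ^+ 2 - c t ^+ 2| <= m ^+ 2 * 3 / 8 * 2.
    rewrite subr_sqr normrM ler_pM//; apply: (le_trans (ler_normD _ _)).
    by rewrite -[leRHS](_ : 1 + 1 = 2%:R) ?lerD ?b.
  move=> /(le_trans (ler_norm _)).
  rewrite exprMn exprVn m2; lra.
exists d => // s /andP[ts std].
have s0 : 0 <= s by rewrite (le_trans t0)// ltW.
(* Taking [sg] to be 1 or -1 makes this one estimate serve for upper and lower bounds on the
   angle. *)
have := @ae_derive_le R (fun s => sg * angle (P s) (E s)) t s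
  (`|sg| * ((m / 2)^-1 * Lc)) k (ltW ts).
rewrite -mulrBr; apply.
  move=> x y tx xy ys; rewrite -mulrBr normrM -mulrA ler_wpM2l//.
  have x0 : 0 <= x := le_trans t0 tx; have y0 : 0 <= y := le_trans x0 xy.
  rewrite !(angle_sphere (rho := rho)); [|by [exact: sphP|exact: sphE]..].
  have := @acos_lipschitz R (m / 2) (c y) (c x).
  rewrite divr_gt0// => /(_ isT); rewrite !cm.
  - move=> /(_ isT isT) /le_trans; apply; rewrite -mulrA ler_wpM2l//.
      by rewrite invr_ge0 divr_ge0// ltW.
    by have := c_lip y0 x0; rewrite (ger0_norm (x := y - x))// subr_ge0.
  - by rewrite tx/=; lra.
  - by rewrite (le_trans tx)//=; lra.
apply: ae_imply aeH => x + /andP[tx xs].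
have tx' : t <= x < t + d by rewrite (ltW tx)/=; lra.
have x0 : 0 <= x by rewrite (le_trans t0)// ltW.
have dd0 : d <= d0 by rewrite ge_min lexx.
case=> [||e de he].
- by rewrite tx/=; lra.
- have /andP[ax ax'] := range x0.
  have cx : c x ^+ 2 < 1.
    have := cm _ tx'; have : 0 < (m / 2) ^+ 2 by rewrite exprn_gt0// divr_gt0.
    lra.
  rewrite !lt_neqAle ax ax' !andbT; apply/andP; split; apply/eqP => h; move: cx.
    by rewrite cE// -h cos0 expr1n ltxx.
  by rewrite cE// h cospi sqrrN expr1n ltxx.
exists (sg * e) => //.
by have := @is_deriveZ _ _ _ _ sg _ _ _ de.
Qed.

(** By contradiction: if capture came after [T], the equations of motion would hold up to [T] and
    keep the angle below the line [b], which vanishes at [T]. *)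
Lemma capture_time_le (t0 k : R) : 0 <= t0 -> 0 < k ->
  0 < angle (P t0) (E t0) < pi -> 
  {ae @lebesgue_measure R, forall s, t0 < s -> (s%:E < capture_time P E)%E ->
    0 < angle (P s) (E s) < pi ->
    exists2 d, is_derive s 1 (fun s => angle (P s) (E s)) d & d <= - k} ->
  (capture_time P E <= (t0 + angle (P t0) (E t0) / k)%:E)%E.
Proof.
move=> t00 k0; set a := angle (P t0) (E t0); move=> /andP[a0 api] aeH.
rewrite leNgt; apply/negP; set T := t0 + a / k => Tlt.
have T0 : t0 < T by rewrite ltrDl divr_gt0.
pose b s := a - k * (s - t0).
have bT : b T = 0 by rewrite /b /T [t0 + _]addrC addrK mulrC divfK ?gt_eqF// subrr.
have brange s : t0 <= s <= T -> 0 <= b s <= a.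
  move=> /andP[ts sT]; rewrite -bT /b; apply/andP; split.
    by rewrite lerD2l lerN2 ler_wpM2l ?(ltW k0)// lerD2r.
  by rewrite gerBl mulr_ge0 ?(ltW k0)// subr_ge0.
have NPE s : 0 <= s <= T -> P s <> E s.
  by apply: (lt_capture_time _).1 => //; exact: le_trans (ltW T0).
pose Q s := angle (P s) (E s) <= b s.
(* In terms of cosines [Q] compares two Lipschitz functions, which is what the limit step
   requires. *)
have QE s : t0 <= s <= T -> Q s <-> cos (b s) <= c s.
  move=> sT; have /andP[b0 ba] := brange _ sT; have /andP[ts _] := sT.
  have s0 := le_trans t00 ts; have r := range s0.
  by rewrite /Q cE// ler_cos// ?in_itv//= b0 (le_trans ba)// ltW.
suff : Q T.
  rewrite /Q bT => aT; have T00 : 0 <= T by exact: le_trans (ltW T0).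
  apply: (NPE T); first by rewrite T00 lexx.
  by apply/(angle_eq0 T00)/eqP; rewrite eq_le aT; case/andP: (range T00).
apply: (@real_induction R t0 T Q) => //; last by rewrite lexx ltW.
- by rewrite /Q /b subrr mulr0 subr0.
- move=> t /andP[t0t tT] IH; have tr : t0 <= t <= T by rewrite (ltW t0t).
  apply/(QE _ tr); rewrite -subr_ge0.
  apply: (@lipschitz_ge0_left _ (fun s => c s - cos (b s)) (Lc + k) t0 t) => //.
  - by rewrite addr_ge0// ltW.
  - move=> s /andP[t0s st]; have s0 := le_trans t00 t0s.
    have := le_trans (ler_norm _) (c_lip s0 (ltW (le_lt_trans s0 st))).
    have := le_trans (ler_norm _) (cos_lipschitz (b t) (b s)).
    have -> : b t - b s = - (k * (t - s)) by rewrite /b; ring.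
    rewrite normrN normrM gtr0_norm// gtr0_norm ?subr_gt0//.
    by rewrite (distrC s) gtr0_norm ?subr_gt0//; lra.
  - move=> s /andP[t0s st]; rewrite subr_ge0; apply/QE.
      by rewrite t0s (le_trans (ltW st)).
    by apply: IH; rewrite t0s.
- move=> t /andP[t0t tT] /(_ t); rewrite t0t lexx => /(_ isT) Qt.
  have tge0 := le_trans t00 t0t.
  (* Positive because no capture has occurred, below [pi] because the angle has not exceeded its
     initial value [a]. *)
  have at_ : 0 < angle (P t) (E t) < pi.
    have tr : t0 <= t <= T by rewrite t0t ltW.
    have /andP[_ ba] := brange _ tr.
    rewrite (le_lt_trans (le_trans Qt ba) api) andbT.
    have /andP[h _] := range tge0; rewrite lt_neqAle h andbT eq_sym.
    apply/eqP => /(angle_eq0 tge0); apply: NPE.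
    by rewrite tge0 ltW.
  have tT0 : 0 < T - t by rewrite subr_gt0.
  have [|d d0 H] := @angle_step 1 (- k) (T - t) t tge0 tT0 at_.
    apply: ae_imply aeH => s H /andP[ts sT] hs.
    have t0s : t0 < s by exact: le_lt_trans ts.
    have sT' : (s%:E < capture_time P E)%E.
      by apply: lt_trans Tlt; rewrite lte_fin; lra.
    by have [d dd dk] := H t0s sT' hs; exists d => //; rewrite mul1r.
  exists d => // s std sT; have := H _ std; rewrite mul1r /Q.
  move: Qt; rewrite /Q /b; lra.
Qed.

(* The antipodal states need no differential equation: there the angle exceeds
   the lower bound a - k (s - t0) < pi, hence still does so shortly after. *)
Lemma capture_time_ge (t0 k : R) : 0 <= t0 -> 0 < k ->
  (forall s, 0 <= s <= t0 -> P s <> E s) ->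
  angle (P t0) (E t0) < pi ->
  {ae @lebesgue_measure R, forall s, t0 < s -> (s%:E < capture_time P E)%E ->
    0 < angle (P s) (E s) < pi ->
    exists2 d, is_derive s 1 (fun s => angle (P s) (E s)) d & - k <= d} ->
  ((t0 + angle (P t0) (E t0) / k)%:E <= capture_time P E)%E.
Proof.
move=> t00 k0 NPE0; set a := angle (P t0) (E t0); move=> api aeH.
set T := t0 + a / k.
pose b s := a - k * (s - t0).
have bT : b T = 0 by rewrite /b /T [t0 + _]addrC addrK mulrC divfK ?gt_eqF// subrr.
have b_gt0 s : s < T -> 0 < b s.
  by move=> sT; rewrite -bT /b ltrD2l ltrN2 ltr_pM2l// ltrD2r.
have b_le s : t0 <= s -> b s <= a.
  by move=> ts; rewrite /b gerBl mulr_ge0 ?(ltW k0)// subr_ge0.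
apply: le_ereal_inf_tmp => _ [u [u0 PEu] <-]; rewrite lee_fin leNgt.
apply/negP => uT; have [ut0|t0u] := leP u t0.
  by apply: (NPE0 u) => //; rewrite u0.
pose Q s := b s <= angle (P s) (E s).
have QE s : t0 <= s <= u -> Q s <-> c s <= cos (b s).
  move=> /andP[ts su]; have s0 := le_trans t00 ts; have r := range s0.
  have sT := le_lt_trans su uT.
  rewrite /Q cE// ler_cos// ?in_itv//= (ltW (b_gt0 _ sT)) (le_trans (b_le _ ts))//.
  exact: ltW.
(* The line [b] is positive before [T], so the lower bound on the past excludes a capture and keeps
   the equations of motion available. *)
have NPE t : t0 <= t <= u -> (forall s, t0 <= s <= t -> Q s) ->
    (t%:E < capture_time P E)%E.
  move=> /andP[t0t tu] Qt; have tge0 := le_trans t00 t0t.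
  apply/(lt_capture_time tge0) => s /andP[s0 st].
  have [st0|t0s] := leP s t0; first by apply: NPE0; rewrite s0.
  move=> /(angle_eq0 s0) as0; have := Qt s; rewrite (ltW t0s) st /Q as0.
  by move=> /(_ isT); rewrite leNgt b_gt0// (le_lt_trans st)// (le_lt_trans tu).
suff : Q u.
  by rewrite /Q ((angle_eq0 u0).2 PEu) leNgt b_gt0.
apply: (@real_induction R t0 u Q) => //; last by rewrite lexx ltW.
- by rewrite /Q /b subrr mulr0 subr0.
- move=> t /andP[t0t tu] IH; have tr : t0 <= t <= u by rewrite (ltW t0t).
  apply/(QE _ tr); rewrite -subr_ge0.
  apply: (@lipschitz_ge0_left _ (fun s => cos (b s) - c s) (Lc + k) t0 t) => //.
  - by rewrite addr_ge0// ltW.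
  - move=> s /andP[t0s st]; have s0 := le_trans t00 t0s.
    have := le_trans (ler_norm _) (c_lip (ltW (le_lt_trans s0 st)) s0).
    have := le_trans (ler_norm _) (cos_lipschitz (b s) (b t)).
    have -> : b s - b t = k * (t - s) by rewrite /b; ring.
    by rewrite normrM gtr0_norm// gtr0_norm ?subr_gt0//; lra.
  - move=> s /andP[t0s st]; rewrite subr_ge0; apply/QE.
      by rewrite t0s (le_trans (ltW st)).
    by apply: IH; rewrite t0s.
- move=> t /andP[t0t tu] IH.
  have tr : t0 <= t <= u by rewrite t0t ltW.
  have tge0 := le_trans t00 t0t.
  have Qt : Q t by apply: IH; rewrite t0t lexx.
  have /andP[_] := range tge0; rewrite le_eqVlt => /orP[/eqP at_pi|at_lt].
    have : c t < cos a.
      rewrite cE// at_pi ltr_cos ?in_itv/= ?lexx ?pi_ge0// (ltW api) andbT.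
      by have /andP[] := range t00.
    move=> /(near_right_lt tge0)[d d0 H]; exists d => // s std su.
    have t0s : t0 <= s by case/andP: std => /ltW /(le_trans t0t).
    apply/QE; first by rewrite t0s.
    apply: (le_trans (ltW (H _ std))); rewrite ler_cos ?b_le//.
      rewrite in_itv/=; apply/andP; split.
        by rewrite ltW// b_gt0// (le_lt_trans su).
      by rewrite (le_trans (b_le _ t0s))// ltW.
    by rewrite in_itv/= (ltW api) andbT; have /andP[] := range t00.
  have [d1 d10 Hd1] := capture_time_gt_near (NPE _ tr IH).
  have at0 : 0 < angle (P t) (E t) < pi.
    by rewrite at_lt andbT (lt_le_trans _ Qt)// b_gt0// (lt_trans tu).
  have [|d d0 H] := @angle_step (- 1) k d1 t tge0 d10 at0.
    apply: ae_imply aeH => s H /andP[ts sT] hs.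
    have t0s : t0 < s by exact: le_lt_trans ts.
    have [d dd dk] := H t0s (Hd1 _ sT) hs.
    by exists d => //; rewrite mulN1r lerNl.
  exists d => // s std sT; have := H _ std; rewrite mulN1r /Q.
  move: Qt; rewrite /Q /b; lra.
Qed.

End CaptureTime.

(** * Plays *)

Lemma lipschitz_nneg (R : realType) (V : normedModType R) (f : R -> V) :
  [lipschitz f t | t in [set t : R | 0 <= t]] <->
  exists2 K, 0 <= K &
    forall s t, 0 <= s -> 0 <= t -> `|f s - f t| <= K * `|s - t|.
Proof.
split=> [/pinfty_ex_gt0[K K0 H]|[K K0 H]].
  by exists K; [exact: ltW|move=> s t s0 t0; exact: (H (s, t))].
apply: (@klipschitzW _ _ _ K).
  by apply: (@globally_properfilter _ _ (0, 0)) => /=.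
by move=> [s t] /= [s0 t0]; exact: H.
Qed.

Section Play.
Variables (R : realType) (rho vP : R) (P0 E0 : 'rV[R]_3).
Variables (sP : @pursuer_strategy R) (sE : @evader_strategy R).
Variables (P E : R -> 'rV[R]_3).
Hypothesis rho_gt0 : 0 < rho.
Hypothesis playPE : play rho vP sP sE P0 E0 P E.

Lemma play_lipschitz : exists2 K, 0 <= K &
  (forall s t, 0 <= s -> 0 <= t -> `|P s - P t| <= K * `|s - t|) /\
  (forall s t, 0 <= s -> 0 <= t -> `|E s - E t| <= K * `|s - t|).
Proof.
have [_ _ /lipschitz_nneg[K K0 HK] /lipschitz_nneg[L L0 HL] _] := playPE.
exists (Num.max K L); first by rewrite le_max K0.
by split=> s t s0 t0; [apply: (le_trans (HK _ _ s0 t0))|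
  apply: (le_trans (HL _ _ s0 t0))]; rewrite ler_wpM2r// le_max lexx ?orbT.
Qed.

Definition separation_rate t :=
  ((sE t (P t) (E t)).1 * cos (sE t (P t) (E t)).2
   - vP * cos (sP t (P t) (E t)).2) / rho.

(** Normals are constrained only after [t0] in order to cover held strategies, which prescribe a
    fixed [n] during the hold, whatever the positions. *)
Lemma play_angle_derive t0 : 0 <= t0 ->
  (forall t X Y, t0 < t -> on_sphere rho X -> on_sphere rho Y ->
    0 < angle X Y < pi -> gc_normal rho X Y (sP t X Y).1) ->
  {ae @lebesgue_measure R, forall s, t0 < s -> (s%:E < capture_time P E)%E ->
    0 < angle (P s) (E s) < pi ->
    is_derive s 1 (fun s => angle (P s) (E s)) (separation_rate s)}.
Proof.
move=> t00 gcn; have [_ sph _ _ aeH] := playPE.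
apply: ae_imply aeH => s H t0s st as_.
have s0 : 0 < s by exact: le_lt_trans t0s.
have [hP hE] := sph _ (ltW s0).
have := gcn _ _ _ t0s hP hE as_; have := H (ltW s0) st; rewrite /separation_rate.
case: (sP s (P s) (E s)) => n uP; case: (sE s (P s) (E s)) => vE uE /= [dP dE] gc.
apply: (angle_is_derive rho_gt0 _ gc as_ dP dE).
by near=> u; apply: sph; near: u; exact: lt_le_nbhsr.
Unshelve. all: by end_near. Qed.

Lemma play_capture_le t0 k : 0 <= t0 -> 0 < k ->
  0 < angle (P t0) (E t0) < pi ->
  (forall t X Y, t0 < t -> on_sphere rho X -> on_sphere rho Y ->
    0 < angle X Y < pi -> gc_normal rho X Y (sP t X Y).1 /\
    ((sE t X Y).1 * cos (sE t X Y).2 - vP * cos (sP t X Y).2) / rho <= - k) ->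
  (capture_time P E <= (t0 + angle (P t0) (E t0) / k)%:E)%E.
Proof.
move=> t00 k0 a0 H; have [_ sph _ _ _] := playPE.
have [K K0 [KP KE]] := play_lipschitz.
apply: (capture_time_le rho_gt0 K0 (fun t h => (sph t h).1)
  (fun t h => (sph t h).2) KP KE t00 k0 a0).
have := @play_angle_derive t0 t00 (fun t X Y h1 h2 h3 h4 => (H t X Y h1 h2 h3 h4).1).
apply: ae_imply => s D t0s st as_; exists (separation_rate s); first exact: D.
have [hP hE] := sph _ (le_trans t00 (ltW t0s)).
exact: (H _ _ _ t0s hP hE as_).2.
Qed.

Lemma play_capture_ge t0 k : 0 <= t0 -> 0 < k ->
  (forall s, 0 <= s <= t0 -> P s <> E s) ->
  angle (P t0) (E t0) < pi ->
  (forall t X Y, t0 < t -> on_sphere rho X -> on_sphere rho Y ->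
    0 < angle X Y < pi -> gc_normal rho X Y (sP t X Y).1 /\
    - k <= ((sE t X Y).1 * cos (sE t X Y).2 - vP * cos (sP t X Y).2) / rho) ->
  ((t0 + angle (P t0) (E t0) / k)%:E <= capture_time P E)%E.
Proof.
move=> t00 k0 NPE a0 H; have [_ sph _ _ _] := playPE.
have [K K0 [KP KE]] := play_lipschitz.
apply: (capture_time_ge rho_gt0 K0 (fun t h => (sph t h).1)
  (fun t h => (sph t h).2) KP KE t00 k0 NPE a0).
have := @play_angle_derive t0 t00 (fun t X Y h1 h2 h3 h4 => (H t X Y h1 h2 h3 h4).1).
apply: ae_imply => s D t0s st as_; exists (separation_rate s); first exact: D.
have [hP hE] := sph _ (le_trans t00 (ltW t0s)).
exact: (H _ _ _ t0s hP hE as_).2.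
Qed.

End Play.

(** * Bounds on the angular rate under the equilibrium strategies *)

Section Equilibrium.
Variables (R : realType) (rho vP mu : R).
Hypotheses (rho_gt0 : 0 < rho) (vP_gt0 : 0 < vP) (mu_gt0 : 0 < mu) (mu_lt1 : mu < 1).
Implicit Types (sP : @pursuer_strategy R) (sE : @evader_strategy R).

Definition closing_rate := (1 - mu) * vP / rho.

Lemma closing_rate_gt0 : 0 < closing_rate.
Proof. by rewrite divr_gt0// mulr_gt0// subr_gt0. Qed.

Lemma value_closing_rate a : value rho vP mu a = a / closing_rate.
Proof.
rewrite /value /closing_rate; field.
by rewrite !gt_eqF// subr_gt0.
Qed.

Lemma pursuer_admissible_gc sP t X Y : pursuer_admissible rho sP ->
  on_sphere rho X -> on_sphere rho Y -> 0 < angle X Y ->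
  gc_normal rho X Y (sP t X Y).1.
Proof. by move=> adm hX hY a0; have [] := adm t X Y hX hY a0. Qed.

Lemma pursuer_star_rate sP sE t X Y :
  pursuer_star rho sP -> evader_admissible rho vP mu sE ->
  on_sphere rho X -> on_sphere rho Y -> 0 < angle X Y < pi ->
  ((sE t X Y).1 * cos (sE t X Y).2 - vP * cos (sP t X Y).2) / rho
    <= - closing_rate.
Proof.
move=> [_ star] adm hX hY a; have /andP[a0 _] := a.
rewrite star// cos0 mulr1; have [/andP[v0 v1] _] := adm t X Y hX hY a0.
rewrite /closing_rate -mulNr ler_pM2r ?invr_gt0//.
have : (sE t X Y).1 * cos (sE t X Y).2 <= (sE t X Y).1 by rewrite ler_piMr// cos_le1.
by move: v1; lra.
Qed.

Lemma evader_star_rate sP sE t X Y : evader_star rho vP mu sE ->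
  on_sphere rho X -> on_sphere rho Y -> 0 < angle X Y < pi ->
  - closing_rate <=
  ((sE t X Y).1 * cos (sE t X Y).2 - vP * cos (sP t X Y).2) / rho.
Proof.
move=> [_ star] hX hY a; have [-> //= _] := star t X Y hX hY.
rewrite cos0 mulr1 /closing_rate -mulNr ler_pM2r ?invr_gt0//.
have : vP * cos (sP t X Y).2 <= vP by rewrite ler_piMr ?cos_le1 ?ltW.
lra.
Qed.

End Equilibrium.

(** * Rotation about a fixed axis *)

Section Rotation.
Variables (R : realType) (rho : R) (n P0 : 'rV[R]_3).
Hypotheses (rho_gt0 : 0 < rho) (nn : dotv n n = 1) (nP : dotv n P0 = 0)
  (PP : dotv P0 P0 = rho ^+ 2).

Lemma gc_curve_is_derive (f : R -> R) (t f' : R) : is_derive t 1 f f' ->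
  is_derive t 1 (fun s => gc_curve n P0 (f s))
    (f' *: crossv n (gc_curve n P0 (f t))).
Proof.
move=> df; apply: is_derive_rV => i.
rewrite (crossv_n_gc_curve nn nP).
have -> : (fun s => gc_curve n P0 (f s) 0 i) =
    (fun s => (cos \o f) s * P0 0 i + (sin \o f) s * crossv n P0 0 i).
  by apply/funext => s; rewrite /gc_curve !mxE.
have dc : is_derive t 1 (cos \o f) (f' * - sin (f t)).
  rewrite mulrC; exact: (is_derive1_comp (is_derive_cos (f t)) df).
have ds : is_derive t 1 (sin \o f) (f' * cos (f t)).
  rewrite mulrC; exact: (is_derive1_comp (is_derive_sin (f t)) df).
apply: is_derive_eq.
by rewrite !mxE /GRing.scale/=; ring.
Qed.

Lemma gc_curve_lipschitz (f : R -> R) (M : R) : 0 <= M ->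
  (forall s t, 0 <= s -> 0 <= t -> `|f s - f t| <= M * `|s - t|) ->
  [lipschitz (gc_curve n P0 (f t)) | t in [set t : R | 0 <= t]].
Proof.
move=> M0 fM; apply/lipschitz_nneg.
exists ((`|P0| + `|crossv n P0|) * M); first by rewrite mulr_ge0// addr_ge0.
move=> s t s0 t0.
have -> : gc_curve n P0 (f s) - gc_curve n P0 (f t) =
   (cos (f s) - cos (f t)) *: P0 + (sin (f s) - sin (f t)) *: crossv n P0.
  by rewrite /gc_curve !scalerBl opprD addrACA.
apply: (le_trans (ler_normD _ _)); rewrite !normrZ -mulrA mulrDl.
have H := fM _ _ s0 t0.
apply: lerD; rewrite mulrC ler_wpM2l//; apply: le_trans H.
  exact: cos_lipschitz.
exact: sin_lipschitz.
Qed.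

Lemma velocity0 (X : 'rV[R]_3) v : velocity rho n X v 0 = (v / rho) *: crossv n X.
Proof. by rewrite /velocity /gc_tangent cos0 sin0 scale0r addr0 scale1r scalerA. Qed.

End Rotation.

Lemma velocity_speed0 (R : realType) (rho : R) (n X : 'rV[R]_3) u :
  velocity rho n X 0 u = 0.
Proof. by rewrite /velocity scale0r. Qed.

(** The product with [n] is skew, so the derivative of [dotv (X s) (Y s)] vanishes almost
    everywhere. The scalar product thus keeps its initial value [rho ^+ 2], the largest possible on
    the sphere, and this forces equality. *)
Lemma rotation_unique (R : realType) (rho K w T : R) (n : 'rV[R]_3)
    (X Y : R -> 'rV[R]_3) :
  0 < rho -> 0 <= K -> 0 <= T ->
  (forall t, 0 <= t -> on_sphere rho (X t)) ->
  (forall t, 0 <= t -> on_sphere rho (Y t)) ->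
  (forall s t, 0 <= s -> 0 <= t -> `|X s - X t| <= K * `|s - t|) ->
  (forall s t, 0 <= s -> 0 <= t -> `|Y s - Y t| <= K * `|s - t|) ->
  X 0 = Y 0 ->
  {ae @lebesgue_measure R, forall s, 0 < s < T ->
    is_derive s 1 X (w *: crossv n (X s)) /\
    is_derive s 1 Y (w *: crossv n (Y s))} ->
  X T = Y T.
Proof.
move=> rho0 K0 T0 sX sY lX lY XY0 aeH.
have := @ae_derive_le R (fun s => - dotv (X s) (Y s)) 0 T (rho *+ 6 * K) 0 T0.
rewrite mul0r opprK => H.
have {}H : - dotv (X T) (Y T) + dotv (X 0) (Y 0) <= 0.
  apply: H.
    move=> s t s0 st _; have t0 := le_trans s0 st.
    rewrite opprK addrC -[t - s]ger0_norm ?subr_ge0// (distrC t).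
    exact: (dotv_lipschitz rho0 sX sY lX lY s0 t0).
  apply: ae_imply aeH => s H sT; have [dX dY] := H sT.
  exists 0 => //; have := is_derive_dotv dX dY.
  rewrite dotvZl dotvZr dotv_crossv (dotvC (X s)) dotv_crossv crossvN.
  rewrite -scaleN1r dotvZr => h; apply: is_derive_eq; ring.
have sX0 := sX _ (lexx 0); have sXT := sX _ T0; have sYT := sY _ T0.
apply: (sphere_eq rho0 sXT sYT); apply/eqP; rewrite eq_le; apply/andP; split.
  have /andP[_] := dotv_sphere_bound rho0 sXT sYT.
  by rewrite ler_pdivrMr ?exprn_gt0// mul1r.
by move: H; rewrite -XY0 (dotv_sphere rho0 sX0); lra.
Qed.

(** * Existence of plays *)

Lemma ae_neq (R : realType) (a : R) :
  {ae @lebesgue_measure R, forall t : R, t <> a}.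
Proof.
exists [set a]; split; [exact: measurable_set1|exact: lebesgue_measure_set1|].
by move=> t /= /contrapT.
Qed.

(* Both players rotate about n: P at rate vP / rho, E at rate mu vP / rho once the
   hold time h is over. *)
Section RotationPlay.
Variables (R : realType) (rho vP mu h : R) (n P0 E0 : 'rV[R]_3).
Variables (sP : @pursuer_strategy R) (sE : @evader_strategy R).
Hypotheses (rho_gt0 : 0 < rho) (vP_gt0 : 0 < vP) (mu_gt0 : 0 < mu) (mu_lt1 : mu < 1).
Hypotheses (sphP : on_sphere rho P0) (sphE : on_sphere rho E0)
  (gcn : gc_normal rho P0 E0 n) (h_ge0 : 0 <= h)
  (h_small : vP * h / rho < angle P0 E0).
Hypothesis hold : forall t X Y, 0 <= t < h ->
  sP t X Y = (n, 0) /\ (sE t X Y).1 = 0.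
Hypothesis star : forall t X Y, h < t -> on_sphere rho X -> on_sphere rho Y ->
  0 < angle X Y < pi ->
  [/\ gc_normal rho X Y (sP t X Y).1, (sP t X Y).2 = 0 & sE t X Y = (mu * vP, 0)].

Let w := vP / rho.
Let a := angle P0 E0.
(** Angular positions of [P] and [E] on the great circle with normal [n], counted from [P0]. The
    corner of [g] at [h] is a null set, at which the equations of motion may fail. *)
Let f t : R := w * t.
Let g t : R := a + mu * w * Num.max (t - h) 0.

Let w_gt0 : 0 < w. Proof. exact: divr_gt0. Qed.

Let f_lip s t : 0 <= s -> 0 <= t -> `|f s - f t| <= w * `|s - t|.
Proof. by move=> _ _; rewrite /f -mulrBr normrM gtr0_norm. Qed.

Let g_lip s t : 0 <= s -> 0 <= t -> `|g s - g t| <= mu * w * `|s - t|.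
Proof.
move=> _ _; have mw : 0 < mu * w by rewrite mulr_gt0.
rewrite /g opprD addrACA subrr add0r -mulrBr normrM gtr0_norm// ler_pM2l//.
rewrite ler_norml; apply/andP.
have := ler_norm (s - t); have := ler_norm (t - s); rewrite distrC.
have := normr_ge0 (s - t).
by case: (leP (s - h) 0); case: (leP (t - h) 0); split; lra.
Qed.

(** After the hold the rotating positions stay on the great circle with normal [n], less than [pi]
    apart. Until capture the strategies are therefore forced to prescribe exactly this motion. *)
Lemma rotation_play : exists P E, play rho vP sP sE P0 E0 P E.
Proof.
have [n1 nP nE nPE] := gcn; have nn : dotv n n = 1.
  by have := (enorm_eq n ler01).1 n1; rewrite expr1n.
have PP := dotv_sphere rho_gt0 sphP.
have /andP[a_ge0 a_lepi] := angle_range rho_gt0 sphP sphE.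
pose P t := gc_curve n P0 (f t); pose E t := gc_curve n P0 (g t).
have sP_ t : on_sphere rho (P t) by exact: on_sphere_gc_curve.
have sE_ t : on_sphere rho (E t) by exact: on_sphere_gc_curve.
have f0 : f 0 = 0 by rewrite /f mulr0.
have g0 : g 0 = a.
  rewrite /g sub0r (_ : Num.max (- h) 0 = 0) ?mulr0 ?addr0//.
  by apply/max_idPr; rewrite oppr_le0.
have mw : 0 < mu * w by rewrite mulr_gt0.
exists P, E; split=> //.
- rewrite /P /E f0 g0 (gc_curve0 n P0); split=> //.
  exact/esym/(gc_normal_curve rho_gt0 sphP sphE gcn).
- exact: gc_curve_lipschitz (ltW w_gt0) f_lip.
- exact: gc_curve_lipschitz (ltW mw) g_lip.
apply: ae_imply (ae_neq h) => t th t0 tlt.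
have dP : is_derive t 1 P (velocity rho n (P t) vP 0).
  rewrite velocity0; apply: (gc_curve_is_derive nn nP).
  by apply: is_derive_eq; rewrite /GRing.scale/= mulr1.
have [tlh|hlt|//] := ltgtP t h.
  have [-> sE0] : sP t (P t) (E t) = (n, 0) /\ (sE t (P t) (E t)).1 = 0.
    by apply: hold; rewrite t0.
  case: (sE t (P t) (E t)) sE0 => vE uE /= ->; split=> //.
  rewrite velocity_speed0.
  apply: (@near_eq_is_derive _ _ _ (cst (gc_curve n P0 a))).
  near=> s; rewrite /= /E /g (_ : Num.max _ _ = 0) ?mulr0 ?addr0//.
  by apply/max_idPr; rewrite subr_le0; near: s; exact: lt_le_nbhsl.
have gE s : h <= s -> g s = a + mu * w * (s - h).
  move=> hs; rewrite /g (_ : Num.max _ _ = s - h)//.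
  by apply/max_idPl; rewrite subr_ge0.
have PE_ne s : 0 <= s <= t -> P s <> E s.
  move=> /andP[s0 st] PEs; move: tlt; rewrite ltNge => /negP; apply.
  apply: (@le_trans _ _ s%:E); last by rewrite lee_fin.
  by apply: ereal_inf_lbound; exists s.
(* From [h] on, the gap [g - f] shrinks at the constant rate [k] and vanishes at [T]; a gap already
   closed at [t] would place the capture at [T <= t]. *)
have dpos : 0 < g t - f t.
  rewrite ltNge; apply/negP => d0.
  pose k := (1 - mu) * w; have k0 : 0 < k by rewrite mulr_gt0// subr_gt0.
  pose T := h + (a - w * h) / k.
  have wh : w * h < a by rewrite /w mulrAC.
  have hT : h <= T by rewrite lerDl divr_ge0 ?subr_ge0 ?(ltW k0) ?(ltW wh).
  have Tk : (T - h) * k = a - w * h.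
    by rewrite /T [h + _]addrC addrK divfK// gt_eqF.
  apply: (PE_ne T).
    rewrite (le_trans h_ge0 hT)/=.
    have : (T - h) * k <= (t - h) * k.
      by rewrite Tk; move: d0; rewrite gE ?(ltW hlt)// /f /k; lra.
    by rewrite ler_pM2r// lerD2r.
  by rewrite /P /E gE// /f; congr (gc_curve n P0 _); move: Tk; rewrite /k; lra.
(* Strict even when [a = pi], because [t > h >= 0] and [P] moves faster. *)
have dpi : g t - f t < pi.
  apply: lt_le_trans a_lepi; rewrite gE ?(ltW hlt)// /f -/a.
  have : mu * w * (t - h) <= mu * w * t by rewrite ler_pM2l// gerBl.
  have : mu * w * t < w * t by rewrite ltr_pM2r ?(le_lt_trans h_ge0)// gtr_pMl.
  by lra.
have angPE : angle (P t) (E t) = g t - f t.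
  by apply: (angle_gc_curve rho_gt0 nn nP PP); rewrite !ltW.
have angPE_in : 0 < angle (P t) (E t) < pi by rewrite angPE dpos.
have [] := star hlt (sP_ t) (sE_ t) angPE_in.
case: (sP t (P t) (E t)) => m uP /= gcm -> ->.
have -> : m = n.
  by apply: (gc_normal_gc_curve rho_gt0 nn nP PP _ gcm); rewrite dpos.
split=> //; rewrite velocity0; apply: (gc_curve_is_derive nn nP).
apply: (@near_eq_is_derive _ _ _ (fun s => a + mu * w * (s - h))).
  by near=> s; rewrite gE//; near: s; exact: lt_le_nbhsr.
by apply: is_derive_eq; rewrite /GRing.scale/= /w; ring.
Unshelve. all: by end_near. Qed.

End RotationPlay.

(** * The antipodal state and the hold *)

Section Antipodal.
Variables (R : realType) (rho vP mu : R).
Hypotheses (rho_gt0 : 0 < rho) (vP_gt0 : 0 < vP) (mu_gt0 : 0 < mu) (mu_lt1 : mu < 1).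

Let D := (1 - mu) * vP.

Let D_gt0 : 0 < D. Proof. by rewrite mulr_gt0// subr_gt0. Qed.

(** [value] is linear in the angle and [angle_hold] affine in [h], so the difference quotient does
    not depend on [h]. *)
Lemma rate_of_lossE vE uE :
  rate_of_loss rho vP mu vE uE = (mu * vP - vE * cos uE) / ((1 - mu) * vP).
Proof.
rewrite /rate_of_loss -[RHS]opprK; congr (- _); apply/cvg_lim => //.
apply: cvg_near_cst; near=> h.
have h0 : h != 0 by rewrite gt_eqF.
rewrite /value /angle_hold; field.
by rewrite h0 !gt_eqF// subr_gt0.
Unshelve. all: by end_near. Qed.

Lemma heading_pi : @heading_range R pi.
Proof. by rewrite /heading_range/= pi_ge0 mulr2n ltrDl pi_gt0. Qed.

(** At a fixed speed the worst heading is [pi], straight towards the approaching [P]. The resulting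
    maximum is strictly increasing in the speed, which singles out speed 0, and at speed 0 the
    heading has no effect on the loss. *)
Lemma rate_of_loss_saddle vE uE :
  attains_saddle_value (speed_range vP mu) heading_range
    (rate_of_loss rho vP mu) vE uE <-> vE = 0 /\ heading_range uE.
Proof.
have muvP : 0 < mu * vP by rewrite mulr_gt0.
have speed0 : speed_range vP mu 0 by rewrite /speed_range/= lexx ltW.
have cpi := @cospi R; have hpi := heading_pi.
split=> [[/= /andP[v0 v1] Hu [m [[M HM [[_ Mm] Mv]] _ _]]]|[-> Hu]].
  split=> //; have [[y _ M0] _] := HM _ speed0.
  have [|_ /(_ _ hpi)] := HM vE; first by rewrite /speed_range/= v0.
  have := Mm _ speed0; rewrite -Mv -M0 => h1 h2; have := le_trans h2 h1.
  by rewrite !rate_of_lossE cpi ler_pM2r ?invr_gt0//; lra.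
split=> //; exists (mu * vP / D); split.
- exists (fun x => (mu * vP + x) / D).
    move=> x /= /andP[x0 x1]; split.
      by exists pi => //; rewrite rate_of_lossE cpi mulrN1 opprK.
    move=> y _; rewrite rate_of_lossE ler_pM2r ?invr_gt0// lerD2l lerNl -mulrN1.
    by rewrite ler_wpM2l// cos_geN1.
  split; last by rewrite addr0.
  split; first by exists 0; rewrite ?addr0.
  by move=> x /= /andP[x0 _]; rewrite ler_pM2r ?invr_gt0// lerDl.
(* At a fixed heading the loss is affine in the speed, hence minimal at an end of the range chosen
   by the sign of [cos y]. *)
- pose Vmin (y : R) := if cos y <= 0 then 0 else mu * vP.
  exists (fun y => (mu * vP - Vmin y * cos y) / D).
    move=> y _; split.
      exists (Vmin y); last by rewrite rate_of_lossE.
      by rewrite /Vmin /speed_range/=; case: ifP => _; rewrite lexx ltW.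
    move=> x /= /andP[x0 x1]; rewrite rate_of_lossE ler_pM2r ?invr_gt0//.
    rewrite lerD2l lerN2 /Vmin; case: ifP => [c0|/negbT].
      by rewrite mul0r mulr_ge0_le0.
    by rewrite -ltNge => c0; rewrite ler_pM2r.
  split; first by exists pi => //; rewrite /Vmin cpi lerN10 mul0r subr0.
  move=> y _; rewrite ler_pM2r ?invr_gt0// gerBl /Vmin; case: ifP => [|/negbT].
    by rewrite mul0r.
  by rewrite -ltNge => c0; rewrite mulr_ge0 ?ltW.
- by rewrite rate_of_lossE mul0r subr0.
Qed.

Lemma star_equilibrium (sP : pursuer_strategy) (sE : evader_strategy) P0 E0 :
  pursuer_star rho sP -> evader_star rho vP mu sE ->
  on_sphere rho P0 -> on_sphere rho E0 -> 0 < angle P0 E0 < pi ->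
  equilibrium rho vP mu sP sE P0 E0 /\
  forall P E, play rho vP sP sE P0 E0 P E ->
    (capture_time P E <= (value rho vP mu (angle P0 E0))%:E)%E.
Proof.
move=> starP starE hP hE a; have /andP[a0 api] := a.
have k0 := closing_rate_gt0 rho_gt0 vP_gt0 mu_lt1.
have upper sE' : evader_admissible rho vP mu sE' ->
    forall P E, play rho vP sP sE' P0 E0 P E ->
    (capture_time P E <= (value rho vP mu (angle P0 E0))%:E)%E.
  move=> admE P E pl; have [[P00 E00] _ _ _ _] := pl.
  rewrite value_closing_rate// -[X in (_ <= X%:E)%E]add0r -P00 -E00.
  apply: (play_capture_le rho_gt0 pl) => //; first by rewrite P00 E00.
  move=> t X Y _ hX hY aXY; split; last exact: (pursuer_star_rate rho_gt0).
  by apply: pursuer_admissible_gc => //; [case: starP|case/andP: aXY].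
have lower sP' : pursuer_admissible rho sP' ->
    forall P E, play rho vP sP' sE P0 E0 P E ->
    ((value rho vP mu (angle P0 E0))%:E <= capture_time P E)%E.
  move=> admP P E pl; have [[P00 E00] _ _ _ _] := pl.
  rewrite value_closing_rate// -[X in (X%:E <= _)%E]add0r -P00 -E00.
  apply: (play_capture_ge rho_gt0 pl) => //; last 1 first.
  - move=> t X Y _ hX hY aXY; split; last exact: evader_star_rate.
    by apply: pursuer_admissible_gc => //; case/andP: aXY.
  - move=> s; rewrite -eq_le => /eqP <-.
    by rewrite P00 E00; apply/(angle_gt0 rho_gt0 hP hE).
  - by rewrite P00 E00.
split; last by apply: upper; case: starE.
split; [by case: starP|by case: starE|exists (value rho vP mu (angle P0 E0))%:E].
split=> //; last first.
  move=> P E pl; apply/eqP; rewrite eq_le; apply/andP; split.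
    by apply: upper pl; case: starE.
  by apply: lower pl; case: starP.
(* Existence of a play: the rotation with an empty hold, [h = 0]. *)
have gc := pursuer_admissible_gc 0 starP.1 hP hE a0.
apply: (@rotation_play _ _ _ mu 0 _ _ _ _ _ rho_gt0 vP_gt0 _ _ hP hE gc) => //.
- by rewrite mulr0 mul0r.
- by move=> t X Y; rewrite leNgt; case: (ltP t 0).
- move=> t X Y _ hX hY aXY; split.
  + by apply: pursuer_admissible_gc => //; [case: starP|case/andP: aXY].
  + exact: starP.2.
  + by have [-> ] := starE.2 t X Y hX hY.
Qed.

(** The held strategies determine the positions up to [h]. From [h] on, with an angle below [pi],
    the upper and lower capture bounds apply at the same rate and coincide. *)
Lemma hold_capture_time (sP : pursuer_strategy) (sE : evader_strategy)
    (P0 E0 n : 'rV[R]_3) (uE h : R) :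
  pursuer_star rho sP -> evader_star rho vP mu sE ->
  on_sphere rho P0 -> on_sphere rho E0 -> angle P0 E0 = pi ->
  gc_normal rho P0 E0 n -> 0 < h -> vP * h / rho < pi ->
  forall P E,
    play rho vP (pursuer_hold h n sP) (evader_hold h 0 uE sE) P0 E0 P E ->
    capture_time P E = (h + value rho vP mu (pi - vP * h / rho))%:E.
Proof.
move=> starP starE hP hE api gc h0 hpi P E pl.
have k0 := closing_rate_gt0 rho_gt0 vP_gt0 mu_lt1.
have [[P00 E00] sph _ _ aeH] := pl.
have [K K0 [KP KE]] := play_lipschitz pl.
have [n1 nP nE nPE] := gc; have nn : dotv n n = 1.
  by have := (enorm_eq n ler01).1 n1; rewrite expr1n.
have PP := dotv_sphere rho_gt0 hP.
pose w := vP / rho; have w0 : 0 < w by rewrite divr_gt0.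
have wE t : vP * t / rho = w * t by rewrite /w mulrAC.
have E0E : E0 = gc_curve n P0 pi by rewrite -api; exact: (gc_normal_curve rho_gt0).
have sC t : on_sphere rho (gc_curve n P0 t) by exact: on_sphere_gc_curve.
have free_lt t : 0 <= t -> (forall s, 0 <= s < t -> P s <> E s) ->
    forall s, 0 <= s < t -> (s%:E < capture_time P E)%E.
  move=> t0 NPE s /andP[s0 st].
  apply/(lt_capture_time rho_gt0 K0 (fun t h => (sph t h).1)
    (fun t h => (sph t h).2) KP KE s0) => u /andP[u0 us].
  by apply: NPE; rewrite u0 (le_lt_trans us).
have pos t : 0 <= t <= h -> (forall s, 0 <= s < t -> P s <> E s) ->
    P t = gc_curve n P0 (w * t) /\ E t = E0.
  move=> /andP[t0 th] NPE; have lt_cap := free_lt _ t0 NPE.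
  have [L L0 HL] : exists2 L, 0 <= L & forall s u, 0 <= s -> 0 <= u ->
      `|gc_curve n P0 (w * s) - gc_curve n P0 (w * u)| <= L * `|s - u|.
    apply/lipschitz_nneg; apply: (@gc_curve_lipschitz _ _ _ _ w); first exact: ltW.
    by move=> s u _ _; rewrite -mulrBr normrM gtr0_norm.
  have KL s u (A B : R) : A <= B -> A * `|s - u| <= B * `|s - u|.
    by move=> AB; rewrite ler_wpM2r.
  split.
  - apply: (@rotation_unique _ rho (Num.max K L) w t n P
      (fun s => gc_curve n P0 (w * s)) rho_gt0 _ t0) => //.
    + by rewrite le_max K0.
    + by move=> s s0; case: (sph s s0).
    + move=> s u s0 u0; apply: (le_trans (KP _ _ s0 u0)).
      by apply: KL; rewrite le_max lexx.
    + move=> s u s0 u0; apply: (le_trans (HL _ _ s0 u0)).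
      by apply: KL; rewrite le_max lexx orbT.
    + by rewrite mulr0 gc_curve0.
    + apply: ae_imply aeH => s H /andP[s0 st].
      have := H (ltW s0); rewrite lt_cap ?(ltW s0)// => /(_ isT).
      rewrite /pursuer_hold /evader_hold (lt_le_trans st th) => -[dP _].
      split; first by rewrite -velocity0.
      by apply: (gc_curve_is_derive nn nP); apply: is_derive_eq;
         rewrite /GRing.scale/= mulr1.
  (* A resting [E] counts as a rotation at rate 0. *)
  - apply: (@rotation_unique _ rho K 0 t n E (fun s => E0) rho_gt0 _ t0) => //.
    + by move=> s s0; case: (sph s s0).
    + by move=> s u s0 u0; rewrite subrr normr0 mulr_ge0.
    + apply: ae_imply aeH => s H /andP[s0 st].
      have := H (ltW s0); rewrite lt_cap ?(ltW s0)// => /(_ isT).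
      rewrite /pursuer_hold /evader_hold (lt_le_trans st th) => -[_].
      rewrite velocity_speed0 !scale0r => dE; split=> //.
      exact: (is_derive_cst E0).
have ang t : 0 <= t <= h -> angle (gc_curve n P0 (w * t)) E0 = pi - w * t.
  move=> /andP[t0 th]; rewrite E0E.
  have wt : w * t <= w * h by rewrite ler_pM2l.
  apply: (angle_gc_curve rho_gt0 nn nP PP); rewrite subr_ge0 gerBl.
  rewrite mulr_ge0 ?(ltW w0)// andbT (le_trans wt)// ltW//.
  by rewrite -wE.
have ang_gt0 t : 0 <= t <= h -> 0 < pi - w * t.
  move=> /andP[t0 th]; have wt : w * t <= w * h by rewrite ler_pM2l.
  by rewrite subr_gt0 (le_lt_trans wt)// -wE.
(* Absence of capture and the position formula feed each other: without capture before [s] the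
   formula holds at [s], where the angle [pi - w * s] is positive, and continuity then delays
   capture a little further. *)
have ne t : 0 <= t <= h -> P t <> E t.
  apply: (@real_induction R 0 h (fun t => P t <> E t)).
  - rewrite P00 E00; apply/(angle_gt0 rho_gt0 hP hE); rewrite api.
    exact: pi_gt0.
  - move=> s /andP[s0 sh] NPE; have sr : 0 <= s <= h by rewrite (ltW s0).
    have [-> ->] := pos _ sr NPE.
    by apply/(angle_gt0 rho_gt0 (sC _) hE); rewrite ang// ang_gt0.
  - move=> s /andP[s0 sh] NPE.
    have charac u (u0 : 0 <= u) := lt_capture_time rho_gt0 K0
      (fun t h => (sph t h).1)
      (fun t h => (sph t h).2) KP KE u0.
    have [d d0 H] := capture_time_gt_near ((charac s s0).2 NPE).
    exists d => // u /andP[su ud] _; have u0 : 0 <= u := le_trans s0 (ltW su).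
    by apply: ((charac u u0).1 (H _ ud)); rewrite u0 lexx.
have hh : 0 <= h <= h by rewrite lexx ltW.
have [Ph Eh] : P h = gc_curve n P0 (w * h) /\ E h = E0.
  by apply: pos => // s /andP[s0 sh]; apply: ne; rewrite s0 ltW.
have angh : angle (P h) (E h) = pi - vP * h / rho by rewrite Ph Eh ang// wE.
have angh_lt : angle (P h) (E h) < pi.
  by rewrite Ph Eh ang// gtrBl mulr_gt0.
have later t X Y : h < t -> pursuer_hold h n sP t X Y = sP t X Y /\
    evader_hold h 0 uE sE t X Y = sE t X Y.
  by move=> ht; rewrite /pursuer_hold /evader_hold ltNge (ltW ht).
rewrite value_closing_rate// -angh; apply/eqP; rewrite eq_le; apply/andP; split.
- apply: (play_capture_le rho_gt0 pl (ltW h0) k0).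
    by rewrite angh_lt Ph Eh ang// ang_gt0.
  move=> t X Y ht hX hY aXY; have [-> ->] := later _ X Y ht.
  split; last by apply: (pursuer_star_rate rho_gt0) => //; case: starE.
  by apply: pursuer_admissible_gc => //; [case: starP|case/andP: aXY].
- apply: (play_capture_ge rho_gt0 pl (ltW h0) k0 ne angh_lt).
  move=> t X Y ht hX hY aXY; have [-> ->] := later _ X Y ht.
  split; last exact: evader_star_rate.
  by apply: pursuer_admissible_gc => //; [case: starP|case/andP: aXY].
Qed.

Lemma hold_play (sP : pursuer_strategy) (sE : evader_strategy)
    (P0 E0 n : 'rV[R]_3) (uE h : R) :
  pursuer_star rho sP -> evader_star rho vP mu sE ->
  on_sphere rho P0 -> on_sphere rho E0 -> angle P0 E0 = pi ->
  gc_normal rho P0 E0 n -> 0 < h -> vP * h / rho < pi ->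
  exists P E,
    play rho vP (pursuer_hold h n sP) (evader_hold h 0 uE sE) P0 E0 P E.
Proof.
move=> starP starE hP hE api gc h0 hpi.
apply: (@rotation_play _ _ _ mu h _ _ _ _ _ rho_gt0 vP_gt0 _ _ hP hE gc) => //.
- exact: ltW.
- by rewrite api.
- by move=> t X Y /andP[_ th]; rewrite /pursuer_hold /evader_hold th.
- move=> t X Y ht hX hY aXY; rewrite /pursuer_hold /evader_hold ltNge (ltW ht)/=.
  split.
  + by apply: pursuer_admissible_gc => //; [case: starP|case/andP: aXY].
  + exact: starP.2.
  + by have [-> ] := starE.2 t X Y hX hY.
Qed.

End Antipodal.

Unset Implicit Arguments.

Theorem theorem2 (R : realType) (rho vP mu : R)
    (rho_gt0 : 0 < rho) (vP_gt0 : 0 < vP) (mu_gt0 : 0 < mu) (mu_lt1 : mu < 1) :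
  (* 0 < alpha < pi: equilibrium and time to capture *)
  (forall (sP : pursuer_strategy) (sE : evader_strategy) (P0 E0 : 'rV[R]_3),
     pursuer_star rho sP -> evader_star rho vP mu sE ->
     on_sphere rho P0 -> on_sphere rho E0 -> 0 < angle P0 E0 < pi ->
     equilibrium rho vP mu sP sE P0 E0 /\
     forall P E, play rho vP sP sE P0 E0 P E ->
       (capture_time P E <= (value rho vP mu (angle P0 E0))%:E)%E) /\
  (* alpha = pi: equilibrium action of E *)
  (forall vE uE : R,
     attains_saddle_value (speed_range vP mu) heading_range
       (rate_of_loss rho vP mu) vE uE <->
     vE = 0 /\ heading_range uE) /\
  (* alpha = pi: time to capture, the same for all directions n of P *)
  (exists eps : R -> R,
     [/\ forall h : R, 0 < h -> vP * h / rho < pi -> 0 < eps h,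
         eps h @[h --> 0^'+] --> (0 : R)
       & forall (sP : pursuer_strategy) (sE : evader_strategy)
           (P0 E0 n : 'rV[R]_3) (uE h : R),
         pursuer_star rho sP -> evader_star rho vP mu sE ->
         on_sphere rho P0 -> on_sphere rho E0 -> angle P0 E0 = pi ->
         gc_normal rho P0 E0 n -> heading_range uE ->
         0 < h -> vP * h / rho < pi ->
         let sPh := pursuer_hold h n sP in
         let sEh := evader_hold h 0 uE sE in
         (exists P E, play rho vP sPh sEh P0 E0 P E) /\
         forall P E, play rho vP sPh sEh P0 E0 P E ->
           ((value rho vP mu pi)%:E - capture_time P E = (eps h)%:E)%E]).
Proof.
split; first by move=> *; exact: (star_equilibrium rho_gt0 vP_gt0 mu_gt0 mu_lt1).
split; first exact: rate_of_loss_saddle.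
have mu1 : 0 < 1 - mu by rewrite subr_gt0.
exists (fun h => mu / (1 - mu) * h); split.
- by move=> h h0 _; rewrite mulr_gt0// divr_gt0.
- rewrite -[X in _ --> X](mulr0 (mu / (1 - mu))); apply: cvgMr.
  by apply: cvg_at_right_filter; exact: cvg_id.
move=> sP sE P0 E0 n uE h starP starE hP hE api gc _ h0 hpi; split.
  exact: (hold_play rho_gt0 vP_gt0 mu_gt0 mu_lt1).
move=> P E pl.
rewrite (hold_capture_time rho_gt0 vP_gt0 mu_lt1 starP starE hP hE api gc h0 hpi pl).
rewrite -EFinB; congr (_%:E); rewrite /value; field.
by rewrite !gt_eqF.
Qed.
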